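(* Let $A$ be a commutative ring, $n\geq 1$, and let $\varphi=(\varphi_1,\ldots,\varphi_n)$ be a collection of invertible elements of $\mathcal L^n(A)$ such that the $(n\times n)$-matrix $\big(\nu(\varphi_1),\ldots,\nu(\varphi_n)\big)$ over $\underline{\mathbb Z}(A)$ is upper-triangular with all diagonal entries equal to $1$. Let $J(\varphi)=\det\left(\frac{\partial\varphi_i}{\partial t_j}\right)\in\mathcal L^n(A)$. Then for any $f\in\mathcal L^n(A)$, there is an equality $$f=\sum_{l\in\mathbb Z^n}\mathrm{res}\big(f\varphi^{-l-1}J(\varphi)\,dt_1\wedge\ldots\wedge dt_n\big)\,\varphi^l,$$ where the series converges in $\mathcal L^n(A)$, and $\varphi^{l}=\varphi_1^{l_1}\cdots\varphi_n^{l_n}$, $\varphi^{-l-1}=\varphi_1^{-l_1-1}\cdots\varphi_n^{-l_n-1}$ for $l=(l_1,\ldots,l_n)$.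
   Context: Rings are commutative, associative and unital. For $n\geq 1$, $\mathcal L^n(A)=A((t_1))\ldots((t_n))$ is the ring of iterated Laurent series (inductively $\mathcal L^1(A)=A((t_1))$, $\mathcal L^n(A)=\mathcal L^{n-1}(A)((t_n))$). Elements are written $f=\sum_{l\in\mathbb Z^n}a_lt^l$ with $t^l=t_1^{l_1}\cdots t_n^{l_n}$, and $\mathrm{supp}(f)=\{l: a_l\neq 0\}$. Put $\Lambda_1=\mathbb Z$, $\mathbb Z^1_\lambda=\{l\in\mathbb Z: l\geq\lambda\}$, and for $n\geq 2$ put $\Lambda_n=\mathrm{Map}(\mathbb Z,\Lambda_{n-1})\times\mathbb Z$ and $\mathbb Z^n_\lambda=\bigcup_{l_n\geq\lambda_n}\mathbb Z^{n-1}_{\lambda'(l_n)}\times\{l_n\}$ for $\lambda=(\lambda',\lambda_n)\in\Lambda_n$. A formal series lies in $\mathcal L^n(A)$ iff its support is contained in $\mathbb Z^n_\lambda$ for some $\lambda\in\Lambda_n$. Topology: $\mathcal L^n(A)$ is a (complete) additive topological group with a base of open neighborhoods of zero given by the $A$-submodules $U_\lambda=\{f:\mathrm{supp}(f)\cap(-\mathbb Z^n_\lambda)=\varnothing\}$, $\lambda\in\Lambda_n$. $\underline{\mathbb Z}(A)$ is the ring of locally constant functions $\mathrm{Spec}(A)\to\mathbb Z$. The lexicographical order on $\mathbb Z^n$ compares the last coordinates first: $(l_1,\ldots,l_n)\leq(l_1',\ldots,l_n')$ iff $l_n<l'_n$, or $l_n=l_n'$ and $(l_1,\ldots,l_{n-1})\leq(l'_1,\ldots,l'_{n-1})$.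 For $f\in\mathcal L^n(A)^*$ it is known that there is a finite decomposition $A\simeq\prod_i A_i$ and elements $l_i\in\mathbb Z^n$ such that the component $\sum_l a_{i,l}t^l\in\mathcal L^n(A_i)$ of $f$ has $a_{i,l}$ nilpotent for all $l<l_i$ and $a_{i,l_i}$ invertible; then $\nu(f)\in\underline{\mathbb Z}(A)^n$ (viewed as a column) is the locally constant function with value $l_i$ on $\mathrm{Spec}(A_i)$, and $\nu:\mathcal L^n(A)^*\to\underline{\mathbb Z}(A)^n$ is a group homomorphism. The residue of $g\,dt_1\wedge\ldots\wedge dt_n$ with $g=\sum_la_lt^l\in\mathcal L^n(A)$ is $\mathrm{res}(g\,dt_1\wedge\ldots\wedge dt_n)=a_{-1\ldots-1}\in A$. *)

(* Defs.v *)
From HB Require Import structures.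
From mathcomp Require Import all_boot all_order all_algebra finmap.
From mathcomp Require Import boolp classical_sets functions fsbigop.
From mathcomp Require Import topology summability.
From mathcomp Require Import zify.

Set Implicit Arguments.
Unset Strict Implicit.
Unset Printing Implicit Defensive.
Import Order.TTheory GRing.Theory Num.Theory.
Local Open Scope classical_set_scope.
Local Open Scope ring_scope.

(* Rings are [comPzRingType]: commutative, unital, possibly zero. *)

Definition invertible (R : comPzRingType) (x : R) : Prop := exists y, x * y = 1.

Definition nilpotent (R : comPzRingType) (x : R) : Prop :=
  exists k : nat, x ^+ k = 0.

(* Mathcomp's unit rings are nontrivial, hence inverses are chosen by hand;
   the value is only meaningful for invertible [x]. *)
Definition inverse (R : comPzRingType) (x : R) : R :=
  xget 0 [set y | x * y = 1].

Definition zexp (R : comPzRingType) (x : R) (k : int) : R :=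
  match k with
  | Posz m => x ^+ m
  | Negz m => inverse x ^+ m.+1
  end.

Section Laurent.
Variable R : comPzRingType.
Implicit Types (a b c : int -> R) (i j k m : int).

Definition bounded_below_pred a : Prop :=
  exists m, forall i, i < m -> a i = 0.

Definition bounded_below : {pred (int -> R)} :=
  fun a => `[< bounded_below_pred a >].

Lemma bounded_below_zmod_closed : zmod_closed bounded_below.
Proof.
split=> [|a b]; first by apply/asboolP; exists 0.
move=> /asboolP[ma Ha] /asboolP[mb Hb]; apply/asboolP.
exists (Num.min ma mb) => i; rewrite lt_min => /andP[ia ib].
by change (a i - b i = 0); rewrite Ha// Hb// subr0.
Qed.

HB.instance Definition _ :=
  GRing.isZmodClosed.Build (int -> R) bounded_below bounded_below_zmod_closed.

Record laurent := Laurent {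
  lcoef : int -> R;
  lcoefP : lcoef \in bounded_below }.

HB.instance Definition _ := [isSub for lcoef].
HB.instance Definition _ := [Choice of laurent by <:].
HB.instance Definition _ := [SubChoice_isSubZmodule of laurent by <:].

Lemma laurentP (f g : laurent) : (forall i, lcoef f i = lcoef g i) -> f = g.
Proof. by move=> fg; apply: val_inj; apply: funext. Qed.

Lemma lcoef_bound (f : laurent) : exists m, forall i, i < m -> lcoef f i = 0.
Proof. by have /asboolP := lcoefP f. Qed.

Lemma lcoef0 i : lcoef 0 i = 0. Proof. by []. Qed.
Lemma lcoefD (f g : laurent) i : lcoef (f + g) i = lcoef f i + lcoef g i.
Proof. by []. Qed.

(* The sum has finite support for bounded below [a] and [b]. *)
Definition conv a b k : R := \sum_(i \in [set: int]) a i * b (k - i).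

Definition win (N : nat) : {fset int} :=
  seq_fset tt [seq n%:Z - N%:Z | n <- iota 0 (N + N).+1].

Lemma mem_win N i : (i \in win N) = (- N%:Z <= i <= N%:Z).
Proof.
rewrite seq_fsetE; apply/mapP/idP => [[n]|iN]; first by rewrite mem_iota => nN ->; lia.
by exists (absz (i + N%:Z)); rewrite ?mem_iota; lia.
Qed.

Lemma conv_win a b ma mb k N :
  (forall i, i < ma -> a i = 0) -> (forall i, i < mb -> b i = 0) ->
  (forall i, ma <= i -> i <= k - mb -> - N%:Z <= i <= N%:Z) ->
  conv a b k = \sum_(i <- win N) a i * b (k - i).
Proof.
move=> Ha Hb HN; apply: fsbigTE => i; rewrite mem_win => iN.
have [ia|ia] := ltP i ma; first by rewrite Ha// mul0r.
have [ib|ib] := leP i (k - mb); first by rewrite HN in iN.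
by rewrite Hb ?mulr0//; lia.
Qed.

Lemma conv_bounded (f g : laurent) : conv (lcoef f) (lcoef g) \in bounded_below.
Proof.
have [mf Hf] := lcoef_bound f; have [mg Hg] := lcoef_bound g.
apply/asboolP; exists (mf + mg) => k kfg; rewrite /conv fsbig1// => i _.
have [?|?] := ltP i mf; first by rewrite Hf// mul0r.
by rewrite Hg ?mulr0//; lia.
Qed.

Lemma convC a b : conv a b = conv b a.
Proof.
apply: funext => k; rewrite /conv.
rewrite (@reindex_fsbigT _ _ _ _ _ (fun i => k - i)); last first.
  by exists (fun i => k - i) => i; lia.
by apply: eq_fsbigr => i _; rewrite mulrC; congr (b _ * _); lia.
Qed.

Definition lmul (f g : laurent) : laurent := Laurent (conv_bounded f g).

Lemma lone_bounded : (fun i => (i == 0)%:R : R) \in bounded_below.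
Proof. by apply/asboolP; exists 0 => i i0; rewrite lt_eqF. Qed.
Definition lone : laurent := Laurent lone_bounded.

Lemma lmulC : commutative lmul.
Proof. by move=> f g; apply: val_inj; exact: convC. Qed.

Lemma lmul1 : left_id lone lmul.
Proof.
move=> f; apply: laurentP => k /=.
rewrite /conv (@fsbigTE _ _ _ _ [fset 0]%fset); last first.
  by move=> i; rewrite inE => /negbTE->; rewrite mul0r.
by rewrite big_seq_fset1 eqxx mul1r subr0.
Qed.

Lemma lmulDl : left_distributive lmul +%R.
Proof.
move=> f g h; apply: laurentP => k.
have [mf Hf] := lcoef_bound f; have [mg Hg] := lcoef_bound g.
have [mh Hh] := lcoef_bound h.
pose N := (absz mf + absz mg + absz mh + absz k)%N.
have Hfg i : i < Num.min mf mg -> lcoef (f + g) i = 0.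
  by rewrite lt_min lcoefD => /andP[? ?]; rewrite Hf// Hg// addr0.
rewrite lcoefD [LHS](@conv_win _ _ _ mh _ N Hfg)//; last first.
  by move=> i; rewrite ge_min /N; lia.
rewrite [lcoef (lmul f h) k]/= [lcoef (lmul g h) k]/=.
rewrite (@conv_win (lcoef f) _ mf mh _ N)//; last by move=> i; rewrite /N; lia.
rewrite (@conv_win (lcoef g) _ mg mh _ N)//; last by move=> i; rewrite /N; lia.
by rewrite -big_split/=; apply: eq_bigr => i _; rewrite -mulrDl.
Qed.

Lemma lmulA : associative lmul.
Proof.
move=> f g h; apply: laurentP => k.
have [mf Hf] := lcoef_bound f; have [mg Hg] := lcoef_bound g.
have [mh Hh] := lcoef_bound h.
have Hfg i : i < mf + mg -> conv (lcoef f) (lcoef g) i = 0.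
  move=> ifg; rewrite /conv fsbig1// => j _.
  have [?|?] := ltP j mf; first by rewrite Hf// mul0r.
  by rewrite Hg ?mulr0//; lia.
have Hgh i : i < mg + mh -> conv (lcoef g) (lcoef h) i = 0.
  move=> igh; rewrite /conv fsbig1// => j _.
  have [?|?] := ltP j mg; first by rewrite Hg// mul0r.
  by rewrite Hh ?mulr0//; lia.
pose N := (absz mf + absz mg + absz mh + absz k)%N.
rewrite /= (@conv_win _ _ mf (mg + mh) _ N)//; last by move=> i; rewrite /N; lia.
rewrite (@conv_win _ (lcoef h) (mf + mg) mh _ N)//; last first.
  by move=> i; rewrite /N; lia.
transitivity (\sum_(i <- win N) \sum_(j <- win N)
    lcoef f j * (lcoef g (i - j) * lcoef h (k - i))).
  rewrite exchange_big/=; apply: eq_bigr => j _.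
  have [?|fj] := ltP j mf.
    by rewrite Hf// mul0r big1// => i _; rewrite mul0r.
  rewrite -big_distrr/=; congr (_ * _).
  rewrite /conv (@reindex_fsbigT _ _ _ _ _ (fun i => i - j)); last first.
    by exists (fun i => i + j) => i; lia.
  rewrite (eq_fsbigr (fun i => lcoef g (i - j) * lcoef h (k - i))); last first.
    by move=> i _; rewrite (_ : k - j - (i - j) = k - i)//; lia.
  rewrite (@fsbigTE _ _ _ _ (win N))// => i; rewrite mem_win => iN.
  have [?|?] := ltP (i - j) mg; first by rewrite Hg// mul0r.
  by rewrite Hh ?mulr0//; lia.
apply: eq_big_seq => i; rewrite mem_win => iN.
have [?|?] := ltP (k - i) mh.
  by rewrite Hh// mulr0 big1// => j _; rewrite !mulr0.
rewrite (@conv_win _ _ mf mg _ N)//; last by move=> j; rewrite /N; lia.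
by rewrite big_distrl/=; apply: eq_bigr => j _; rewrite mulrA.
Qed.

HB.instance Definition _ :=
  GRing.Zmodule_isComPzRing.Build laurent lmulA lmulC lmul1 lmulDl.

End Laurent.

Section LaurentOperators.
Variables R S : comPzRingType.

Lemma lconst_bounded (c : R) :
  (fun i => if i == 0 then c else 0) \in @bounded_below R.
Proof. by apply/asboolP; exists 0 => i i0; rewrite lt_eqF. Qed.

Definition lconst (c : R) : laurent R := Laurent (lconst_bounded c).

(* [lmap h] applies [h] to every coefficient; additivity of [h] gives
   [h 0 = 0], so that the support stays bounded below. *)
Lemma lmap_bounded (h : {additive R -> S}) (f : laurent R) :
  (fun i => h (lcoef f i)) \in @bounded_below S.
Proof.
have [m Hf] := lcoef_bound f.
by apply/asboolP; exists m => i im; rewrite Hf// raddf0.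
Qed.

Definition lmap (h : {additive R -> S}) (f : laurent R) : laurent S :=
  Laurent (lmap_bounded h f).

Lemma lmap_is_zmod_morphism (h : {additive R -> S}) : zmod_morphism (lmap h).
Proof. by move=> f g; apply: laurentP => i; rewrite /= raddfB. Qed.

HB.instance Definition _ (h : {additive R -> S}) :=
  GRing.isZmodMorphism.Build (laurent R) (laurent S) (lmap h)
    (lmap_is_zmod_morphism h).

Lemma lderiv_bounded (f : laurent R) :
  (fun i => lcoef f (i + 1) *~ (i + 1)) \in @bounded_below R.
Proof.
have [m Hf] := lcoef_bound f.
by apply/asboolP; exists (m - 1) => i im; rewrite Hf ?mul0rz// -ltrBDr.
Qed.

Definition lderiv (f : laurent R) : laurent R := Laurent (lderiv_bounded f).

Lemma lderiv_is_zmod_morphism : zmod_morphism lderiv.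
Proof. by move=> f g; apply: laurentP => i; rewrite /= mulrzBl. Qed.

HB.instance Definition _ :=
  GRing.isZmodMorphism.Build (laurent R) (laurent R) lderiv
    lderiv_is_zmod_morphism.

End LaurentOperators.

(* Iterated Laurent series A((t_1))...((t_n)).  Coordinates of Z^n are indexed
   by 'I_n, and the outermost variable t_n corresponds to [ord_max]. *)
Fixpoint iterLaurent (A : comPzRingType) (n : nat) : comPzRingType :=
  if n is n'.+1 then laurent (iterLaurent A n') else A.

Section IterLaurent.
Variable A : comPzRingType.

Fixpoint icoef (n : nat) : iterLaurent A n -> 'cV[int]_n -> A :=
  match n with
  | 0 => fun f _ => f
  | n'.+1 => fun f l => icoef (lcoef f (l ord_max 0)) (row' ord_max l)
  end.

Fixpoint iconst (n : nat) (c : A) : iterLaurent A n :=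
  match n return iterLaurent A n with
  | 0 => c
  | n'.+1 => lconst (iconst n' c)
  end.

(* The partial derivative with respect to t_j. *)
Fixpoint ipartial (n : nat) :
    'I_n -> {additive iterLaurent A n -> iterLaurent A n} :=
  match n return 'I_n -> {additive iterLaurent A n -> iterLaurent A n} with
  | 0 => fun _ => idfun
  | n'.+1 => fun j =>
      if unlift ord_max j is Some j' then lmap (ipartial j') else @lderiv _
  end.

(* The residue of the top form g dt_1 /\ ... /\ dt_n. *)
Definition res (n : nat) (g : iterLaurent A n) : A := icoef g (const_mx (-1)).

Definition jacobian (n : nat) (phi : 'I_n -> iterLaurent A n) :
    iterLaurent A n :=
  \det (\matrix_(i, j) ipartial j (phi i)).

Definition mpow (n : nat) (phi : 'I_n -> iterLaurent A n) (l : 'cV[int]_n) :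
    iterLaurent A n :=
  \prod_i zexp (phi i) (l i 0).

End IterLaurent.

Arguments ipartial {A n} j.

Fixpoint Lambda (n : nat) : Type :=
  if n is n'.+1 then ((int -> Lambda n') * int)%type else unit.

(* The set Z^n_lambda.  Starting at n = 0 gives [Lambda 1] as
   Map(Z, unit) * Z, that is Z, and the condition l_1 >= lambda. *)
Fixpoint Zge (n : nat) : Lambda n -> set 'cV[int]_n :=
  match n return Lambda n -> set 'cV[int]_n with
  | 0 => fun _ => setT
  | n'.+1 => fun lam => [set l : 'cV[int]_n'.+1 | lam.2 <= l ord_max 0 /\
                Zge (lam.1 (l ord_max 0)) (row' ord_max l)]
  end.

Fixpoint Lambda_min (n : nat) : Lambda n -> Lambda n -> Lambda n :=
  match n return Lambda n -> Lambda n -> Lambda n with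
  | 0 => fun _ _ => tt
  | n'.+1 => fun lam mu =>
      (fun k => Lambda_min (lam.1 k) (mu.1 k), Num.min lam.2 mu.2)
  end.

Lemma Zge_minl n (lam mu : Lambda n) : Zge lam `<=` Zge (Lambda_min lam mu).
Proof.
elim: n lam mu => //= n IH lam mu l [l1 l2].
by split; [rewrite ge_min l1|exact: IH].
Qed.

Lemma Zge_minr n (lam mu : Lambda n) : Zge mu `<=` Zge (Lambda_min lam mu).
Proof.
elim: n lam mu => //= n IH lam mu l [l1 l2].
by split; [rewrite ge_min l1 orbT|exact: IH].
Qed.

Section Topology.
Variables (A : comPzRingType) (n : nat).

(* U_lambda: the support does not meet - Z^n_lambda. *)
Definition Unbhd (lam : Lambda n) : set (iterLaurent A n) :=
  [set f | forall l, Zge lam (- l) -> icoef f l = 0].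

Definition iterLaurent_top : Type := iterLaurent A n.

HB.instance Definition _ := Choice.copy iterLaurent_top (iterLaurent A n).

Definition iterLaurent_nbhs (f : iterLaurent_top) : set_system iterLaurent_top :=
  filter_from setT (fun lam : Lambda n => [set g | Unbhd lam (g - f)]).

Lemma icoefB (f g : iterLaurent A n) l : icoef (f - g) l = icoef f l - icoef g l.
Proof. by elim: n f g l => //= n' IH f g l; rewrite -IH. Qed.

Lemma icoef0 l : icoef (0 : iterLaurent A n) l = 0.
Proof. by have := icoefB 0 0 l; rewrite !subrr. Qed.

Lemma UnbhdD lam f g : Unbhd lam f -> Unbhd lam g -> Unbhd lam (f + g).
Proof.
move=> Uf Ug l Zl; rewrite -[g]opprK !icoefB -[- g]sub0r icoefB icoef0.
by rewrite Uf// Ug// !subr0.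
Qed.

HB.instance Definition _ := hasNbhs.Build iterLaurent_top iterLaurent_nbhs.

Lemma iterLaurent_nbhs_filter (f : iterLaurent_top) : ProperFilter (nbhs f).
Proof.
apply: filter_from_proper => [|lam _]; last first.
  by exists f => l _; rewrite subrr icoef0.
apply: filter_fromT_filter => [|lam mu].
  by elim: {f} n => [|n' [lam]]; [exists tt|exists (fun=> lam, 0)].
exists (Lambda_min lam mu) => g Ug.
by split=> l Zl; apply: Ug; [exact: Zge_minl|exact: Zge_minr].
Qed.

Lemma iterLaurent_nbhs_singleton (f : iterLaurent_top) (V : set iterLaurent_top) :
  nbhs f V -> V f.
Proof. by move=> [lam _]; apply=> l _; rewrite subrr icoef0. Qed.

Lemma iterLaurent_nbhs_nbhs (f : iterLaurent_top) (V : set iterLaurent_top) :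
  nbhs f V -> nbhs f (nbhs^~ V).
Proof.
move=> [lam _ UV]; exists lam => // g Ug; exists lam => // h Uh.
apply: UV => /=; rewrite -(subrK g h) -addrA; exact: UnbhdD.
Qed.

HB.instance Definition _ := Nbhs_isNbhsTopological.Build iterLaurent_top
  iterLaurent_nbhs_filter iterLaurent_nbhs_singleton iterLaurent_nbhs_nbhs.

(* The family [x] is summable in L^n(A), with sum [f]. *)
Definition sums_to (I : choiceType) (x : I -> iterLaurent A n)
    (f : iterLaurent A n) : Prop :=
  (partial_sum x : {fset I} -> iterLaurent_top) @ totally
    --> (f : iterLaurent_top).

End Topology.

Section Spec.

Definition prime_ideal (A : comPzRingType) (I : set A) : Prop :=
  [/\ I 0, forall a b, I a -> I b -> I (a + b),
      forall a b, I b -> I (a * b), ~ I 1 &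
      forall a b, I (a * b) -> I a \/ I b].

Record Spec (A : comPzRingType) := MkSpec {
  spec_ideal :> set A;
  specP : prime_ideal spec_ideal }.

HB.instance Definition _ (A : comPzRingType) := gen_eqMixin (Spec A).
HB.instance Definition _ (A : comPzRingType) := gen_choiceMixin (Spec A).

(* The closed sets of the Zariski topology are the
   V(E) = {p | E `<=` p} for E a subset of A. *)
Definition Zariski_open (A : comPzRingType) : set_system (Spec A) :=
  [set U | exists E : set A, U = [set p : Spec A | ~ (E `<=` p)]].

Lemma Zariski_openT A : @Zariski_open A setT.
Proof.
exists setT; apply/seteqP; split=> // p _ /= /(_ 1 I).
by have [_ _ _ + _] := specP p.
Qed.

Lemma Zariski_openI A : setI_closed (@Zariski_open A).
Proof.
move=> _ _ [E ->] [F ->]; exists [set c | exists a b, [/\ E a, F b & c = a * b]].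
apply/seteqP; split=> p /=; have [p0 pD pM p1 pP] := specP p.
- move=> [nE nF] EF; apply: nE => a Ea; apply: contrapT => npa; apply: nF => b Fb.
  by have /pP[] : spec_ideal p (a * b) by apply: EF; exists a, b.
- move=> nEF; split=> H; apply: nEF => _ [a [b [Ea Fb ->]]].
    by rewrite mulrC; apply: pM; exact: H.
  by apply: pM; exact: H.
Qed.

Lemma Zariski_open_bigU A (I : Type) (U : I -> set (Spec A)) :
  (forall i, Zariski_open (U i)) -> Zariski_open (\bigcup_i U i).
Proof.
move=> /choice[E UE]; exists (\bigcup_i E i); apply/seteqP; split=> p /=.
  by move=> [i _]; rewrite UE => nEp Ep; apply: nEp => a Ea; apply: Ep; exists i.
move=> nEp; apply: contrapT => nU; apply: nEp => a [i _ Ea].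
apply: contrapT => npa; apply: nU; exists i => //.
by rewrite UE => /(_ _ Ea).
Qed.

HB.instance Definition _ (A : comPzRingType) := isOpenTopological.Build (Spec A)
  (@Zariski_openT A) (@Zariski_openI A) (@Zariski_open_bigU A).

Lemma comap_prime (A B : comPzRingType) (h : {rmorphism A -> B}) (q : Spec B) :
  prime_ideal (h @^-1` q).
Proof.
have [q0 qD qM q1 qP] := specP q; split=> /=.
- by rewrite rmorph0.
- by move=> a b qa qb; rewrite rmorphD; exact: qD.
- by move=> a b qb; rewrite rmorphM; exact: qM.
- by rewrite rmorph1.
- by move=> a b; rewrite rmorphM; exact: qP.
Qed.

Definition Spec_map (A B : comPzRingType) (h : {rmorphism A -> B})
    (q : Spec B) : Spec A := MkSpec (comap_prime h q).

(* The ring of locally constant functions Spec(A) -> Z. *)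
Variable A : comPzRingType.

Definition locally_constant : {pred (Spec A -> int)} :=
  fun u => `[< forall p, \forall q \near p, u q = u p >].

Lemma locally_constant_subring_closed : subring_closed locally_constant.
Proof.
split=> [|u v|u v]; first by apply/asboolP => p; exact: (@nearW _ (nbhs p)).
- move=> /asboolP Hu /asboolP Hv; apply/asboolP => p.
  near=> q; change (u q - v q = u p - v p); congr (_ - _).
    by near: q; exact: Hu.
  by near: q; exact: Hv.
- move=> /asboolP Hu /asboolP Hv; apply/asboolP => p.
  near=> q; change (u q * v q = u p * v p); congr (_ * _).
    by near: q; exact: Hu.
  by near: q; exact: Hv.
Unshelve. all: by end_near. Qed.

HB.instance Definition _ := GRing.isSubringClosed.Build (Spec A -> int)
  locally_constant locally_constant_subring_closed.

Record Zlc := MkZlc {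
  Zlc_fun :> Spec A -> int;
  ZlcP : Zlc_fun \in locally_constant }.

HB.instance Definition _ := [isSub for Zlc_fun].
HB.instance Definition _ := [Choice of Zlc by <:].
HB.instance Definition _ := 
  GRing.SubChoice_isSubComPzRing.Build _ _ Zlc locally_constant_subring_closed.

End Spec.

(* The lexicographical order on Z^n comparing the last coordinates first. *)
Fixpoint lex_le (n : nat) : 'cV[int]_n -> 'cV[int]_n -> bool :=
  match n return 'cV[int]_n -> 'cV[int]_n -> bool with
  | 0 => fun _ _ => true
  | n'.+1 => fun l l' =>
      (l ord_max 0 < l' ord_max 0) ||
      (l ord_max 0 == l' ord_max 0) &&
      lex_le (row' ord_max l) (row' ord_max l')
  end.

Definition lex_lt (n : nat) (l l' : 'cV[int]_n) : bool :=
  (l != l') && lex_le l l'.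

Section Valuation.
Variables (A : comPzRingType) (n : nat).

(* [v] is the column of locally constant functions attached to [f] by a finite
   decomposition of [A] as a product of the rings [B i], where [pi i] is the
   projection onto [B i]. *)
Definition is_nu (f : iterLaurent A n) (v : 'cV[Zlc A]_n) : Prop :=
  exists (m : nat) (B : 'I_m -> comPzRingType)
         (pi : forall i, {rmorphism A -> B i}) (l : 'I_m -> 'cV[int]_n),
    [/\ forall b : (forall i, B i), exists! a : A, forall i, pi i a = b i,
        forall i k, lex_lt k (l i) -> nilpotent (pi i (icoef f k)),
        forall i, invertible (pi i (icoef f (l i))) &
        forall i (q : Spec (B i)),
          map_mx (fun u : Zlc A => u (Spec_map (pi i) q)) v = l i].

(* Every invertible [f] satisfies [is_nu f v] for a unique [v]; the value of
   [nu] at other series is irrelevant. *)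
Definition nu (f : iterLaurent A n) : 'cV[Zlc A]_n := xget 0 [set v | is_nu f v].

(* The matrix with columns nu(phi_1), ..., nu(phi_n). *)
Definition nu_mx (phi : 'I_n -> iterLaurent A n) : 'M[Zlc A]_n :=
  \matrix_(i, j) nu (phi j) i 0.

End Valuation.

Definition is_upper_trig_mx (V : nmodType) (n : nat) (M : 'M[V]_n) : bool :=
  is_trig_mx M^T.

(* Main.v *)
Require Import Defs.
From HB Require Import structures.
From mathcomp Require Import all_boot all_order fingroup perm all_algebra finmap.
From mathcomp Require Import boolp classical_sets functions fsbigop.
From mathcomp Require Import topology summability.
From mathcomp Require Import zify ring.
From mathcomp Require Import monalg.

Set Implicit Arguments.
Unset Strict Implicit.
Unset Printing Implicit Defensive.
Import Order.TTheory GRing.Theory Num.Theory.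
Local Open Scope ring_scope.

(* Write J for the Jacobian.  Replacing phi_i by e phi_i + (1 - e) t^l for the
   idempotents e of the decompositions defining nu makes every nu(phi_i)
   constant.  Then phi_i = p_i + q_i with q_i nilpotent and no term of p_i below
   the leading exponent; nilpotency of q_i, and not only of its coefficients,
   uses the invertibility of phi_i.  The system (p_i + s q_i)_i together with the
   extra variable s has no nilpotent lower terms, and specializing its expansion
   at s = 1 gives that of phi.

   For a system without nilpotent lower terms, the coefficients
   res (f phi^(-l-1) J) make the series summable with some sum F.  By the
   orthogonality res (phi^k J) = [k = -1], the residues of (f - F) J phi^k all
   vanish, and comparing lowest terms in t_n gives f = F.  The orthogonality for
   k <> -1 holds because (k_i + 1) phi^k J is a sum of derivatives over any ring;
   the factor k_i + 1 is cancelled after lifting to the torsion-free monoid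
   ring Z[A]. *)

(** * Powers of invertible elements and orders of Laurent series *)

(** Two facts force the detour through s. A series with infinitely many nilpotent coefficients need
    not be nilpotent, and nilpotent terms below the leading exponent defeat every argument by
    leading terms. Since s is the outermost variable of the deformed system, s q_i counts as a
    higher-order term, and the leading terms are those of p_i. Since q_i is nilpotent, all powers of
    p_i + s q_i are Laurent polynomials in s whose degrees are bounded independently of the
    exponent, so that s = 1 can be substituted and only finitely many powers of s contribute.

    Summability needs control that is uniform in l: for y of positive order, each coefficient of (1
    + y)^l is a combination of finitely many fixed ring elements with integer weights depending on
    l. This reduces n variables to n - 1.

    The lift goes to Z[A] rather than to a polynomial ring over Z because units have to lift to
    units. *)

Section InvertibleElements.
Variable R : comPzRingType.
Implicit Types x y z : R.

Lemma mulr_inj_inv x y z : x * y = 1 -> x * z = 1 -> y = z.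
Proof. by move=> xy xz; rewrite -[y]mulr1 -xz mulrA [y * x]mulrC xy mul1r. Qed.

Lemma mulr_inverse x : invertible x -> x * inverse x = 1.
Proof. by move=> /= [y xy]; rewrite /inverse; case: xgetP => [z _ ->//|/(_ y)]. Qed.

Lemma inverse_uniq x y : x * y = 1 -> inverse x = y.
Proof. by move=> xy; apply: (@mulr_inj_inv x) => //; apply: mulr_inverse; exists y. Qed.

Lemma invertibleM x y : invertible x -> invertible y -> invertible (x * y).
Proof. by move=> [a xa] [b yb]; exists (a * b); rewrite mulrACA xa yb mulr1. Qed.

Lemma invertible1 : invertible (1 : R).
Proof. by exists 1; rewrite mulr1. Qed.

Lemma inverseM x y : invertible x -> invertible y ->
  inverse (x * y) = inverse x * inverse y.
Proof.
by move=> ix iy; apply: inverse_uniq; rewrite mulrACA !mulr_inverse// mulr1.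
Qed.

Lemma zexp0 x : zexp x 0 = 1. Proof. by []. Qed.
Lemma zexpN1 x : zexp x (-1) = inverse x. Proof. by []. Qed.

Lemma zexpS x k : invertible x -> zexp x (k + 1) = zexp x k * x.
Proof.
move=> ix; case: k => [m|[|m]]; first by rewrite -PoszD addn1 /= exprSr.
  by rewrite /= expr1 mulrC mulr_inverse.
rewrite (_ : Negz m.+1 + 1 = Negz m); last by lia.
by rewrite /= [in RHS]exprSr -mulrA [inverse x * x]mulrC mulr_inverse// mulr1.
Qed.

Lemma zexpB1 x k : invertible x -> zexp x (k - 1) = zexp x k * inverse x.
Proof.
move=> ix; have := zexpS (k - 1) ix; rewrite subrK => ->.
by rewrite -mulrA mulr_inverse// mulr1.
Qed.

Lemma zexpD x k m : invertible x -> zexp x (k + m) = zexp x k * zexp x m.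
Proof.
move=> ix; elim: m => [|m IH|m IH]; first by rewrite addr0 mulr1.
  by rewrite -addn1 PoszD addrA !zexpS// IH mulrA.
rewrite (_ : - m.+1%:Z = - m%:Z - 1); last by lia.
by rewrite addrA !zexpB1// IH mulrA.
Qed.

Lemma zexpM x y k : invertible x -> invertible y ->
  zexp (x * y) k = zexp x k * zexp y k.
Proof. by move=> ix iy; case: k => m /=; rewrite ?inverseM// exprMn. Qed.

Lemma invertibleX x m : invertible x -> invertible (x ^+ m).
Proof. by move=> [y xy]; exists (y ^+ m); rewrite -exprMn xy expr1n. Qed.

Lemma invertible_inverse x : invertible x -> invertible (inverse x).
Proof. by move=> ix; exists x; rewrite mulrC mulr_inverse. Qed.

Lemma invertible_zexp x k : invertible x -> invertible (zexp x k).
Proof.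
by move=> ix; case: k => m; apply: invertibleX => //; exact: invertible_inverse.
Qed.

End InvertibleElements.

Lemma rmorph_invertible (R S : comPzRingType) (h : {rmorphism R -> S}) x :
  invertible x -> invertible (h x).
Proof. by move=> [y xy]; exists (h y); rewrite -rmorphM xy rmorph1. Qed.

Lemma rmorph_inverse (R S : comPzRingType) (h : {rmorphism R -> S}) x :
  invertible x -> h (inverse x) = inverse (h x).
Proof.
by move=> ix; apply/esym/inverse_uniq; rewrite -rmorphM mulr_inverse// rmorph1.
Qed.

Lemma rmorph_zexp (R S : comPzRingType) (h : {rmorphism R -> S}) x k :
  invertible x -> h (zexp x k) = zexp (h x) k.
Proof. by move=> ix; case: k => m /=; rewrite rmorphXn ?rmorph_inverse. Qed.

Section LaurentOrder.
Variable R : comPzRingType.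
Implicit Types (f g y : laurent R) (m k : int).

Definition ordge m f := forall i, i < m -> lcoef f i = 0.

Lemma ordge_exists f : exists m, ordge m f.
Proof. exact: lcoef_bound. Qed.

Lemma ordgeW m k f : k <= m -> ordge m f -> ordge k f.
Proof. by move=> km fm i ik; apply: fm; apply: lt_le_trans km. Qed.

Lemma ordge1 : ordge 0 1.
Proof. by move=> i i0; rewrite /= lt_eqF. Qed.

Lemma ordgeD m f g : ordge m f -> ordge m g -> ordge m (f + g).
Proof. by move=> fm gm i im; rewrite lcoefD fm// gm// addr0. Qed.

Lemma lcoefN f k : lcoef (- f) k = - lcoef f k. Proof. by []. Qed.
Lemma lcoefB f g k : lcoef (f - g) k = lcoef f k - lcoef g k. Proof. by []. Qed.
Lemma lcoef1 k : lcoef (1 : laurent R) k = (k == 0)%:R. Proof. by []. Qed.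

Lemma ordgeN m f : ordge m f -> ordge m (- f).
Proof. by move=> fm i im; rewrite lcoefN fm// oppr0. Qed.

Lemma lcoef_sum (I : Type) (r : seq I) (P : pred I) (F : I -> laurent R) k :
  lcoef (\sum_(i <- r | P i) F i) k = \sum_(i <- r | P i) lcoef (F i) k.
Proof.
by apply: (big_morph (fun f => lcoef f k)) => [f g|]; rewrite ?lcoefD.
Qed.

Lemma ordge_sum (I : Type) (r : seq I) (P : pred I) (F : I -> laurent R) m :
  (forall i, P i -> ordge m (F i)) -> ordge m (\sum_(i <- r | P i) F i).
Proof. by move=> Fm k km; rewrite lcoef_sum big1// => i Pi; exact: Fm. Qed.

Lemma lcoefM_win f g mf mg k N : ordge mf f -> ordge mg g ->
  (absz mf + absz mg + absz k <= N)%N ->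
  lcoef (f * g) k = \sum_(i <- win N) lcoef f i * lcoef g (k - i).
Proof. by move=> fm gm kN; apply: (@conv_win _ _ _ mf mg) => // i; lia. Qed.

Lemma lcoefM_ord f g mf mg (p : nat) : ordge mf f -> ordge mg g ->
  lcoef (f * g) (mf + mg + p%:Z) =
  \sum_(i < p.+1) lcoef f (mf + i%:Z) * lcoef g (mg + (p - i)%N%:Z).
Proof.
move=> fm gm.
transitivity (\sum_(i <- seq_fset tt [seq mf + n%:Z | n <- iota 0 p.+1])
   lcoef f i * lcoef g (mf + mg + p%:Z - i)).
  apply: fsbigTE => i; rewrite seq_fsetE => /mapP iN.
  have [?|fi] := ltP i mf; first by rewrite fm// mul0r.
  have [?|gi] := ltP (mf + mg + p%:Z - i) mg; first by rewrite gm// mulr0.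
  by case: iN; exists (absz (i - mf)); rewrite ?mem_iota; lia.
rewrite (perm_big _ (uniq_perm (fset_uniq _) _ (seq_fsetE _ _))); last first.
  by rewrite map_inj_uniq ?iota_uniq// => a b; lia.
rewrite big_map -[iota 0 p.+1]/(index_iota 0 p.+1) big_mkord.
by apply: eq_bigr => i _; congr (_ * lcoef g _); have := ltn_ord i; lia.
Qed.

Lemma ordgeM mf mg f g : ordge mf f -> ordge mg g -> ordge (mf + mg) (f * g).
Proof.
move=> fm gm k km; rewrite (@lcoefM_win f g mf mg k _ fm gm (leqnn _)).
rewrite big1// => i _.
have [?|fi] := ltP i mf; first by rewrite fm// mul0r.
by rewrite (gm (k - i)) ?mulr0//; lia.
Qed.

Lemma leadM mf mg f g : ordge mf f -> ordge mg g ->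
  lcoef (f * g) (mf + mg) = lcoef f mf * lcoef g mg.
Proof.
move=> fm gm; have := lcoefM_ord 0 fm gm.
by rewrite big_ord1 !addr0.
Qed.

Lemma ordge_prod (I : Type) (r : seq I) (P : pred I) (F : I -> laurent R) :
  (forall i, P i -> ordge 0 (F i)) -> ordge 0 (\prod_(i <- r | P i) F i).
Proof.
move=> F0; apply: (big_ind (ordge 0)) => //; first exact: ordge1.
by move=> f g f0 g0; rewrite -[0]addr0; exact: ordgeM.
Qed.

Lemma lead_prod (I : Type) (r : seq I) (F : I -> laurent R) :
  (forall i, ordge 0 (F i)) ->
  lcoef (\prod_(i <- r) F i) 0 = \prod_(i <- r) lcoef (F i) 0.
Proof.
move=> F0; elim: r => [|i r IH]; first by rewrite !big_nil.
by rewrite !big_cons -[X in lcoef _ X]addr0 leadM ?IH//; exact: ordge_prod.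
Qed.

Lemma ordgeX m f (p : nat) : ordge m f -> ordge (m *+ p) (f ^+ p).
Proof.
move=> fm; elim: p => [|p IH]; first exact: ordge1.
by rewrite exprS mulrS; exact: ordgeM.
Qed.

Lemma leadX m f (p : nat) : ordge m f ->
  lcoef (f ^+ p) (m *+ p) = lcoef f m ^+ p.
Proof.
move=> fm; elim: p => [|p IH]; first by rewrite !expr0.
by rewrite !exprS mulrS leadM ?IH//; exact: ordgeX.
Qed.

Lemma ordge_eq0 f : (forall N : nat, ordge N%:Z f) -> f = 0.
Proof. by move=> f0; apply: laurentP => k; apply: (f0 (absz k).+1); lia. Qed.

Lemma lmono_bounded (c : R) m : (fun i => if i == m then c else 0) \in @bounded_below R.
Proof. by apply/asboolP; exists m => i im; rewrite lt_eqF. Qed.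

Definition lmono (c : R) m : laurent R := Laurent (lmono_bounded c m).

Lemma lcoef_lmonoM c m f k : lcoef (lmono c m * f) k = c * lcoef f (k - m).
Proof.
rewrite [LHS]/= /conv (@fsbigTE _ _ _ _ [fset m]%fset).
  by rewrite big_seq_fset1 eqxx.
by move=> i; rewrite inE => /negbTE->; rewrite mul0r.
Qed.

Lemma lmonoM c d m k : lmono c m * lmono d k = lmono (c * d) (m + k).
Proof.
apply: laurentP => i; rewrite lcoef_lmonoM /= subr_eq [k + m]addrC.
by case: ifP; rewrite ?mulr0.
Qed.

Lemma lmono1 : lmono 1 0 = 1.
Proof. by apply: laurentP => i /=; case: ifP. Qed.

Lemma lmonoN c m : lmono (- c) m = - lmono c m.
Proof. by apply: laurentP => i; rewrite lcoefN /=; case: ifP; rewrite ?oppr0. Qed.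

Lemma ordge_lmono c m : ordge m (lmono c m).
Proof. by move=> i im /=; rewrite lt_eqF. Qed.

Lemma lmono_decomp m f : ordge m f -> ordge (m + 1) (f - lmono (lcoef f m) m).
Proof.
move=> fm i im; rewrite lcoefB /=; case: eqP => [->|]; first by rewrite subrr.
by move=> im'; rewrite subr0; apply: fm; lia.
Qed.

(** The inverse is the geometric series of y: as y^j has order at least j, its coefficient at k is a
    finite sum over j <= |k|. The product with 1 - y is then compared with 1 up to every order N. *)
Lemma invertible1B y : ordge 1 y -> invertible (1 - y).
Proof.
move=> y1.
have yX (j : nat) : ordge j%:Z (y ^+ j).
  by have := ordgeX (p := j) y1; rewrite -mulr_natl mulr1 natz.
pose a k := \sum_(j < (absz k).+1) lcoef (y ^+ j) k.
have ab : a \in @bounded_below R.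
  apply/asboolP; exists 0 => i i0; rewrite /a big1// => j _.
  by apply: (yX j); lia.
have gE (N : nat) : ordge N%:Z (Laurent ab - \sum_(j < N) y ^+ j).
  move=> i iN; rewrite lcoefB lcoef_sum /=; apply/eqP; rewrite subr_eq0 /a.
  have [i0|i0] := ltP i 0.
    by rewrite !big1// => j _; apply: (yX j); lia.
  apply/eqP; rewrite (big_ord_widen N (fun j => lcoef (y ^+ j) i)); last by lia.
  rewrite big_mkcond; apply: eq_bigr => j _; case: ifP => // ji.
  by rewrite (yX j)//; lia.
exists (Laurent ab); apply/eqP; rewrite -subr_eq0; apply/eqP.
apply: ordge_eq0 => N.
rewrite -[Laurent ab](subrK (\sum_(j < N) y ^+ j)) mulrDr.
have -> : (1 - y) * (\sum_(j < N) y ^+ j) = 1 - y ^+ N.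
  rewrite -opprB mulNr.
  elim: (N) => [|M IH]; first by rewrite big_ord0 mulr0 oppr0 subrr.
  rewrite big_ord_recr /= mulrDr opprD IH exprS.
  by rewrite mulrBl mul1r opprB addrA subrK.
rewrite -addrA [1 - y ^+ N]addrC addrK; apply: ordgeD; last exact: ordgeN.
have y0 : ordge 0 (1 - y).
  by apply: ordgeD; [exact: ordge1|apply/ordgeN; exact: ordgeW y1].
by rewrite -[N%:Z]add0r; exact: ordgeM.
Qed.

Lemma invertible_lmono c m : invertible c -> invertible (lmono c m).
Proof. by move=> [d cd]; exists (lmono d (- m)); rewrite lmonoM cd subrr lmono1. Qed.

Lemma invertible_lead m f : ordge m f -> invertible (lcoef f m) -> invertible f.
Proof.
move=> fm [d cd].
pose c := lcoef f m.
(* Divided by its leading monomial, f is 1 minus a series of positive order. *)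
have -> : f = lmono c m * (1 - lmono (- d) (- m) * (f - lmono c m)).
  rewrite mulrBr mulr1 mulrA lmonoM subrr mulrN cd lmonoN lmono1 mulN1r opprK.
  by rewrite addrC subrK.
apply: invertibleM; first by apply: invertible_lmono; exists d.
apply: invertible1B; apply: (@ordgeW (- m + (m + 1))); first by lia.
by apply: ordgeM; [exact: ordge_lmono|exact: lmono_decomp].
Qed.

Lemma inverse_ord m f : ordge m f -> invertible (lcoef f m) ->
  ordge (- m) (inverse f) /\ lcoef (inverse f) (- m) = inverse (lcoef f m).
Proof.
move=> fm ic; have := mulr_inverse (invertible_lead fm ic).
set g := inverse f => fg.
suff gm : ordge (- m) g.
  split=> //; apply/esym/inverse_uniq.
  by rewrite -leadM// fg subrr.
have [k gk] := ordge_exists g.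
(* An order bound k + p of g below -m improves by one: the coefficient of f g at m + k + p is the
   product of the two leading coefficients, it vanishes, and that of f is invertible. *)
suff H (p : nat) : ordge (- m) g \/ ordge (k + p%:Z) g.
  case: (H (absz (- m - k))) => // gp; apply: ordgeW gp; lia.
elim: p => [|p [IH|IH]]; [by right; rewrite addr0|by left|].
have [kp|kp] := leP (- m) (k + p%:Z); first by left; apply: ordgeW IH.
right=> i ip; have [?|ik] := ltP i (k + p%:Z); first exact: IH.
have -> : i = k + p%:Z by lia.
have : lcoef f m * lcoef g (k + p%:Z) = 0.
  by rewrite -leadM// fg lcoef1 lt_eqF//; lia.
move=> /(congr1 (fun z => inverse (lcoef f m) * z)).
by rewrite mulrA [_ * lcoef f m]mulrC mulr_inverse// mul1r mulr0.
Qed.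

Lemma zexp_ord m f k : ordge m f -> invertible (lcoef f m) ->
  ordge (m * k) (zexp f k) /\ lcoef (zexp f k) (m * k) = zexp (lcoef f m) k.
Proof.
move=> fm ic; case: k => p.
  by rewrite -mulrzz -pmulrn; split; [exact: ordgeX|exact: leadX].
have [gm gc] := inverse_ord fm ic.
have -> : m * Negz p = - m *+ p.+1 by rewrite NegzE mulrN -mulNr pmulrn mulrzz.
by split; [exact: ordgeX|rewrite /= leadX// gc].
Qed.

End LaurentOrder.

(** * Functoriality and derivations *)

Section LaurentMorphisms.
Variables R S : comPzRingType.

Lemma lcoef_lmap (h : {additive R -> S}) (f : laurent R) k :
  lcoef (lmap h f) k = h (lcoef f k).
Proof. by []. Qed.

Lemma lcoef_lderiv (f : laurent R) k :
  lcoef (lderiv f) k = lcoef f (k + 1) *~ (k + 1).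
Proof. by []. Qed.

Lemma lmap_ordge (h : {additive R -> S}) m (f : laurent R) :
  ordge m f -> ordge m (lmap h f).
Proof. by move=> fm i im; rewrite /= fm// raddf0. Qed.

Lemma lmap_is_monoid_morphism (h : {rmorphism R -> S}) : monoid_morphism (lmap h).
Proof.
split=> [|f g].
  by apply: laurentP => i; rewrite [LHS]/= lcoef1 rmorph_nat.
have [mf fm] := ordge_exists f; have [mg gm] := ordge_exists g.
apply: laurentP => k; rewrite -[LHS]/(h (lcoef (f * g) k)).
rewrite (lcoefM_win fm gm (leqnn _)) rmorph_sum.
rewrite (lcoefM_win (lmap_ordge h fm) (lmap_ordge h gm) (leqnn _)).
by apply: eq_bigr => i _; rewrite rmorphM.
Qed.

HB.instance Definition _ (h : {rmorphism R -> S}) :=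
  GRing.isMonoidMorphism.Build (laurent R) (laurent S) (lmap h)
    (lmap_is_monoid_morphism h).

Lemma lconstE (c : R) : lconst c = lmono c 0.
Proof. exact: laurentP. Qed.

Lemma lcoef_lconstM (c : R) (f : laurent R) k : lcoef (lconst c * f) k = c * lcoef f k.
Proof. by rewrite lconstE lcoef_lmonoM subr0. Qed.

Lemma lconst_is_zmod_morphism : zmod_morphism (@lconst R).
Proof.
by move=> a b; apply: laurentP => i; rewrite lcoefB /=; case: ifP; rewrite ?subr0.
Qed.

Lemma lconst_is_monoid_morphism : monoid_morphism (@lconst R).
Proof.
by split=> [|a b]; rewrite !lconstE ?lmono1// lmonoM addr0.
Qed.

HB.instance Definition _ := GRing.isZmodMorphism.Build R (laurent R) (@lconst R)
  lconst_is_zmod_morphism.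
HB.instance Definition _ := GRing.isMonoidMorphism.Build R (laurent R) (@lconst R)
  lconst_is_monoid_morphism.

End LaurentMorphisms.

Definition derivation (R : comPzRingType) (d : R -> R) : Prop :=
  forall x y, d (x * y) = d x * y + x * d y.

Section LaurentDerivations.
Variable R : comPzRingType.
Implicit Types f g : laurent R.

Lemma lmap_derivation (d : {additive R -> R}) : derivation d -> derivation (lmap d).
Proof.
move=> dD f g.
have [mf fm] := ordge_exists f; have [mg gm] := ordge_exists g.
have dfm := lmap_ordge d fm; have dgm := lmap_ordge d gm.
apply: laurentP => k; rewrite lcoefD -[LHS]/(d (lcoef (f * g) k)).
rewrite (lcoefM_win fm gm (leqnn _)) raddf_sum.
rewrite (lcoefM_win dfm gm (leqnn _)) (lcoefM_win fm dgm (leqnn _)).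
by rewrite -big_split; apply: eq_bigr => i _; exact: dD.
Qed.

Lemma lderiv_derivation : derivation (@lderiv R).
Proof.
move=> f g; apply: laurentP => k; rewrite lcoefD /=.
(* With both convolutions taken at k + 1, the two derivatives become the weights i and k + 1 - i,
   which add up to k + 1. *)
have -> : conv (fun i => lcoef f (i + 1) *~ (i + 1)) (lcoef g) k =
          conv (fun i => lcoef f i *~ i) (lcoef g) (k + 1).
  rewrite [RHS]/conv (@reindex_fsbigT _ _ _ _ _ (fun i => i + 1)); last first.
    by exists (fun i => i - 1) => i; lia.
  by apply: eq_fsbigr => i _; congr (_ * lcoef g _); lia.
have -> : conv (lcoef f) (fun i => lcoef g (i + 1) *~ (i + 1)) k =
          conv (lcoef f) (fun i => lcoef g i *~ i) (k + 1).
  by apply: eq_fsbigr => i _; rewrite (_ : k - i + 1 = k + 1 - i)//; lia.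
have [mf fm] := ordge_exists f; have [mg gm] := ordge_exists g.
pose N := (absz mf + absz mg + absz (k + 1)%R)%N.
have iN i : mf <= i -> i <= k + 1 - mg -> - N%:Z <= i <= N%:Z by rewrite /N; lia.
have fm' i : i < mf -> lcoef f i *~ i = 0 by move=> im; rewrite fm ?mul0rz.
have gm' i : i < mg -> lcoef g i *~ i = 0 by move=> im; rewrite gm ?mul0rz.
rewrite (conv_win fm gm iN) (conv_win fm' gm iN) (conv_win fm gm' iN).
rewrite -big_split mulrz_suml; apply: eq_bigr => i _ /=.
by rewrite mulrzAl mulrzAr -mulrzDr; congr (_ *~ _); lia.
Qed.

Lemma lmap_lderivC (d : {additive R -> R}) f : lmap d (lderiv f) = lderiv (lmap d f).
Proof. by apply: laurentP => k /=; rewrite raddfMz. Qed.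

End LaurentDerivations.

Section ColumnExtension.
Variable n : nat.

Definition colext (k : int) (l : 'cV[int]_n) : 'cV[int]_n.+1 :=
  \col_i (if unlift ord_max i is Some j then l j 0 else k).

Lemma colext_max k l : colext k l ord_max 0 = k.
Proof. by rewrite mxE unlift_none. Qed.

Lemma colext_lift k l i : colext k l (lift ord_max i) 0 = l i 0.
Proof. by rewrite mxE liftK. Qed.

Lemma row'_colext k l : row' ord_max (colext k l) = l.
Proof. by apply/colP => i; rewrite !mxE liftK. Qed.

Lemma colextK (l : 'cV[int]_n.+1) : colext (l ord_max 0) (row' ord_max l) = l.
Proof.
by apply/colP => i; rewrite !mxE; case: unliftP => [j ->|->]; rewrite ?mxE.
Qed.

Lemma row'_const (a : int) : row' ord_max (const_mx a : 'cV_n.+1) = const_mx a.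
Proof. by apply/colP => i; rewrite !mxE. Qed.

End ColumnExtension.

Section IteratedLaurent.
Variable A : comPzRingType.
Implicit Types n : nat.

Lemma ipartial_derivation n (j : 'I_n) : derivation (@ipartial A n j).
Proof.
elim: n j => [[]//|n IH] j /=.
case: unliftP => [j' _|_]; first exact: lmap_derivation.
exact: lderiv_derivation.
Qed.

Lemma ipartialC n (i j : 'I_n) (f : iterLaurent A n) :
  ipartial i (ipartial j f) = ipartial j (ipartial i f).
Proof.
elim: n i j f => [[]//|n IH] i j f /=.
case: unliftP => [i' _|_]; case: unliftP => [j' _|_] //.
- by apply: laurentP => k /=; rewrite IH.
- exact: lmap_lderivC.
- by apply/esym; exact: lmap_lderivC.
Qed.

Lemma icoefN n (f : iterLaurent A n) l : icoef (- f) l = - icoef f l.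
Proof. by rewrite -sub0r icoefB icoef0 sub0r. Qed.

Lemma icoefD n (f g : iterLaurent A n) l : icoef (f + g) l = icoef f l + icoef g l.
Proof. by rewrite -[g]opprK icoefB !icoefN opprK. Qed.

Lemma icoef_sum n (I : Type) (r : seq I) (P : pred I) (F : I -> iterLaurent A n) l :
  icoef (\sum_(i <- r | P i) F i) l = \sum_(i <- r | P i) icoef (F i) l.
Proof.
by apply: (big_morph (fun f => icoef f l)) => [f g|]; rewrite ?icoefD ?icoef0.
Qed.

Lemma res_sum n (I : Type) (r : seq I) (P : pred I) (F : I -> iterLaurent A n) :
  res (\sum_(i <- r | P i) F i) = \sum_(i <- r | P i) res (F i).
Proof. exact: icoef_sum. Qed.

Lemma iconst_is_zmod_morphism n : zmod_morphism (@iconst A n).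
Proof. by elim: n => //= n IH a b; rewrite IH raddfB. Qed.

Lemma iconst_is_monoid_morphism n : monoid_morphism (@iconst A n).
Proof.
elim: n => [//|n [IH1 IHM]] /=; split => [|a b]; first by rewrite IH1 rmorph1.
by rewrite IHM rmorphM.
Qed.

HB.instance Definition _ n := GRing.isZmodMorphism.Build A (iterLaurent A n)
  (@iconst A n) (@iconst_is_zmod_morphism n).
HB.instance Definition _ n := GRing.isMonoidMorphism.Build A (iterLaurent A n)
  (@iconst A n) (@iconst_is_monoid_morphism n).

Lemma icoefS n (f : iterLaurent A n.+1) l :
  icoef f l = icoef (lcoef f (l ord_max 0)) (row' ord_max l).
Proof. by []. Qed.

Lemma icoef_iconstM n c (f : iterLaurent A n) l : icoef (iconst n c * f) l = c * icoef f l.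
Proof.
by elim: n f l => // n IH f l; rewrite !icoefS [iconst _ _]/= lcoef_lconstM IH.
Qed.

Lemma ipartial_iconstM n (j : 'I_n) c (f : iterLaurent A n) :
  ipartial j (iconst n c * f) = iconst n c * ipartial j f.
Proof.
elim: n j f => [[]//|n IH] j f; apply: laurentP => k.
rewrite [iconst n.+1 c]/= lcoef_lconstM [ipartial _]/=.
case: unliftP => [j' _|_]; first by rewrite !lcoef_lmap lcoef_lconstM IH.
by rewrite !lcoef_lderiv lcoef_lconstM mulrzAr.
Qed.

Lemma res_ipartial n (j : 'I_n) (f : iterLaurent A n) : res (ipartial j f) = 0.
Proof.
rewrite /res; elim: n j f => [[]//|n IH] j f; rewrite /= !mxE.
case: unliftP => [j' _|_] /=.
  by rewrite row'_const IH.
by rewrite addNr mulr0z icoef0.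
Qed.

End IteratedLaurent.

Section IteratedMap.
Variables (A B : comPzRingType) (h : {rmorphism A -> B}).

Fixpoint imap n : {rmorphism iterLaurent A n -> iterLaurent B n} :=
  match n return {rmorphism iterLaurent A n -> iterLaurent B n} with
  | 0 => h
  | n'.+1 => lmap (imap n')
  end.

Lemma icoef_imap n (f : iterLaurent A n) l : icoef (imap n f) l = h (icoef f l).
Proof. by elim: n f l => //= n IH f l; rewrite IH. Qed.

Lemma ipartial_imap n (j : 'I_n) (f : iterLaurent A n) :
  ipartial j (imap n f) = imap n (ipartial j f).
Proof.
elim: n j f => [[]//|n IH] j f; apply: laurentP => k /=.
by case: unliftP => [j' _|_] /=; rewrite ?IH// raddfMz.
Qed.

End IteratedMap.

Section MonomialPowers.
Variables (A : comPzRingType) (n : nat).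
Implicit Types phi psi : 'I_n -> iterLaurent A n.

Lemma mpow0 phi : mpow phi 0 = 1.
Proof. by rewrite /mpow big1// => i _; rewrite mxE zexp0. Qed.

Lemma mpowD phi l m : (forall i, invertible (phi i)) ->
  mpow phi (l + m) = mpow phi l * mpow phi m.
Proof.
move=> iphi; rewrite /mpow -big_split; apply: eq_bigr => i _.
by rewrite mxE zexpD.
Qed.

End MonomialPowers.

Lemma imap_mpow (A B : comPzRingType) (h : {rmorphism A -> B}) n
    (phi : 'I_n -> iterLaurent A n) l : (forall i, invertible (phi i)) ->
  imap h n (mpow phi l) = mpow (fun i => imap h n (phi i)) l.
Proof.
by move=> iphi; rewrite rmorph_prod; apply: eq_bigr => i _; rewrite rmorph_zexp.
Qed.

Lemma imap_jacobian (A B : comPzRingType) (h : {rmorphism A -> B}) n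
    (phi : 'I_n -> iterLaurent A n) :
  imap h n (jacobian phi) = jacobian (fun i => imap h n (phi i)).
Proof.
rewrite /jacobian -det_map_mx; congr (\det _).
by apply/matrixP => i j; rewrite !mxE ipartial_imap.
Qed.

(** * Exactness of Jacobian forms *)

Section DerivationRules.
Variables (K : comPzRingType) (d : {additive K -> K}).
Hypothesis dM : derivation d.

Lemma derivation1 : d 1 = 0.
Proof. by have := dM 1 1; rewrite !mulr1 mul1r => /eqP; rewrite addrC -subr_eq subrr => /eqP. Qed.

Lemma derivation_prod (I : finType) (P : pred I) (F : I -> K) :
  d (\prod_(i | P i) F i) =
  \sum_(i | P i) d (F i) * \prod_(k | P k && (k != i)) F k.
Proof.
(* One duplicate-free list of the indices in P serves all three big operators, which allows
   induction on it. *)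
have [r [ur rP]] : exists r : seq I, uniq r /\ forall F0 : I -> K,
    \prod_(i | P i) F0 i = \prod_(i <- r) F0 i /\
    \sum_(i | P i) F0 i = \sum_(i <- r) F0 i /\
    forall j, \prod_(i | P i && (i != j)) F0 i = \prod_(i <- r | i != j) F0 i.
  exists [seq i <- index_enum I | P i]; split; first by rewrite filter_uniq ?index_enum_uniq.
  move=> F0; split; first by rewrite big_filter.
  by split=> [|j]; [rewrite big_filter|rewrite big_filter_cond].
have [-> _] := rP F; rewrite (proj1 (proj2 (rP _))).
rewrite [RHS](eq_bigr (fun i => d (F i) * \prod_(k <- r | k != i) F k)); last first.
  by move=> i _; rewrite (proj2 (proj2 (rP _))).
elim: r ur {rP} => [_|x r IH /= /andP[xr ur]]; first by rewrite !big_nil derivation1.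
rewrite !big_cons dM IH// eqxx /=; congr (d _ * _ + _).
  rewrite [RHS]big_seq_cond [LHS]big_seq_cond; apply: eq_bigl => i /=.
  by rewrite andbT; case: (boolP (i \in r)) => //= ir; apply/esym/eqP => ix; rewrite -ix ir in xr.
rewrite big_distrr /=; apply: eq_big_seq => i ir; rewrite big_cons.
by case: eqP => [ix|_] /=; [rewrite ix ir in xr|rewrite mulrCA].
Qed.

Lemma derivation_zexp x k : invertible x -> d (zexp x k) = zexp x (k - 1) * d x *~ k.
Proof.
move=> ix; elim: k => [|m IH|m IH]; first by rewrite zexp0 derivation1.
  rewrite -addn1 PoszD zexpS// dM IH addrK mulrzAl mulrAC -zexpS// subrK.
  by rewrite mulrzDr mulr1z.
have ixi := invertible_inverse ix.
set k := - m.+1%:Z; have kE : - m%:Z = k + 1 by rewrite /k; lia.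
(* Negative exponents descend: the known derivative of x^(k + 1) = x^k x is solved for d (x^k). *)
have : d (zexp x k * x) = zexp x k * d x *~ (k + 1).
  by rewrite -zexpS// -kE IH kE addrK.
rewrite dM mulrzDr mulr1z => /(addIr _) /(congr1 (fun z => z * inverse x)).
rewrite -mulrA mulr_inverse// mulr1 => ->.
by rewrite mulrzAl mulrAC -zexpB1.
Qed.

End DerivationRules.

Section Exactness.
Variables (K : comPzRingType) (M : zmodType) (n : nat).
Variables (d : 'I_n -> {additive K -> K}) (rho : {additive K -> M}).
Hypothesis dM : forall j, derivation (d j).
Hypothesis dC : forall i j x, d i (d j x) = d j (d i x).
Hypothesis rho_d : forall j x, rho (d j x) = 0.

Let Jac (phi : 'I_n -> K) := \det (\matrix_(i, j) d j (phi i)).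

(* The form d phi_1 /\ ... /\ d phi_n is exact: expand the determinant, write
   each term as a derivative of phi_i0 times the rest, and cancel the second
   derivatives in pairs. *)
Lemma exact_jacobian (i0 : 'I_n) (phi : 'I_n -> K) : rho (Jac phi) = 0.
Proof.
pose P (s : 'S_n) := \prod_(i | i != i0) d (s i) (phi i).
have E (s : 'S_n) : \prod_i (\matrix_(i, j) d j (phi i)) i (s i) =
    d (s i0) (phi i0 * P s) - phi i0 * d (s i0) (P s).
  rewrite dM addrK (bigD1 i0)//= mxE; congr (_ * _).
  by apply: eq_bigr => i _; rewrite mxE.
rewrite /Jac /determinant (eq_bigr (fun s : 'S_n =>
  (-1) ^+ s * d (s i0) (phi i0 * P s) - phi i0 * ((-1) ^+ s * d (s i0) (P s)))); last first.
  by move=> s _; rewrite E mulrBr [X in _ - X = _]mulrCA.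
rewrite sumrB raddfB /= raddf_sum big1 ?sub0r; last first.
  by move=> s _; rewrite mulr_sign; case: odd_perm; rewrite ?raddfN/= rho_d ?oppr0.
rewrite -big_distrr /=.
suff -> : \sum_(s : 'S_n) (-1) ^+ s * d (s i0) (P s) = 0 by rewrite mulr0 raddf0 oppr0.
pose G i1 (s : 'S_n) := d (s i0) (d (s i1) (phi i1)) *
  \prod_(k | (k != i0) && (k != i1)) d (s k) (phi k).
rewrite (eq_bigr (fun s : 'S_n => \sum_(i1 | i1 != i0) (-1) ^+ s * G i1 s)); last first.
  by move=> s _; rewrite derivation_prod// big_distrr.
rewrite exchange_big big1 //= => i1 i10.
(* Composing s with t exchanges the two derivatives applied to phi_i1; they commute, so [G i1] is
   unchanged while the sign of s flips. *)
pose t := tperm i0 i1.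
have Gt s : G i1 (t * s)%g = G i1 s.
  rewrite /G !permM tpermL tpermR dC; congr (_ * _).
  by apply: eq_bigr => k /andP[k0 k1]; rewrite permM tpermD // eq_sym.
have oddMt s : (t * s)%g = ~~ s :> bool by rewrite odd_permM odd_tperm eq_sym i10.
rewrite (bigID (@odd_perm _)) /=; apply: canLR (subrK _) _; rewrite add0r -sumrN.
rewrite (reindex_inj (mulgI t)); apply: eq_big => //= s.
by rewrite oddMt => /negPf->; rewrite mulN1r mul1r Gt.
Qed.

(** X and Y have the same cofactors along row i0, so the expansion of Y there yields entries of X
    times its adjugate, which vanish off the diagonal. *)
Lemma det_row_combination (X : 'M[K]_n) (i0 : 'I_n) (c : 'I_n -> K) (Y : 'M[K]_n) :
  (forall i j, i != i0 -> Y i j = X i j) ->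
  (forall j, Y i0 j = \sum_i c i * X i j) -> \det Y = c i0 * \det X.
Proof.
move=> YX Y0; rewrite (expand_det_row Y i0).
have cof j : cofactor Y i0 j = \adj X j i0.
  rewrite mxE /cofactor; congr (_ * \det _).
  by apply/matrixP => i k; rewrite !mxE YX// eq_sym neq_lift.
rewrite (eq_bigr (fun j => \sum_i c i * (X i j * \adj X j i0))); last first.
  by move=> j _; rewrite Y0 cof big_distrl; apply: eq_bigr => i _; rewrite mulrA.
rewrite exchange_big (bigD1 i0)//= [X in _ + X]big1 ?addr0 => [|i i00].
  by rewrite -big_distrr /=; have := mul_mx_adj X => /matrixP /(_ i0 i0); rewrite !mxE eqxx => ->.
rewrite -big_distrr /=; have := mul_mx_adj X => /matrixP /(_ i i0).
by rewrite !mxE (negPf i00) => ->; rewrite mulr0.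
Qed.

(** [exact_jacobian] applies to the system in which phi_i0 is replaced by phi_i0^(k_i0 + 1) times
    the phi_i^(k_i), i <> i0; its Jacobian is k_i0 + 1 times the given form. *)
Lemma exact_monomial_jacobian (phi : 'I_n -> K) (k : 'cV[int]_n) (i0 : 'I_n) :
  (forall i, invertible (phi i)) ->
  rho ((\prod_i zexp (phi i) (k i 0)) * Jac phi) *~ (k i0 0 + 1) = 0.
Proof.
move=> iphi.
pose X := \prod_(i | i != i0) zexp (phi i) (k i 0).
pose psi i := if i == i0 then zexp (phi i0) (k i0 0 + 1) * X else phi i.
rewrite -raddfMz -mulrzAl -[RHS](exact_jacobian i0 psi); congr (rho _).
(* The differential of X involves only the d phi_i with i <> i0, so it adds multiples of other rows
   and leaves the determinant alone. *)
have [c [c0 cE]] : exists c : 'I_n -> K, c i0 = 0 /\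
    forall j, d j X = \sum_i c i * d j (phi i).
  apply: (big_ind (fun X => exists c : 'I_n -> K, c i0 = 0 /\
    forall j, d j X = \sum_i c i * d j (phi i))).
  - exists (fun=> 0); split=> // j.
    by rewrite derivation1// big1// => i _; rewrite mul0r.
  - move=> x y [cx [cx0 xE]] [cy [cy0 yE]]; exists (fun i => cx i * y + x * cy i).
    rewrite cx0 cy0 mul0r mulr0 addr0; split=> // j.
    rewrite dM xE yE big_distrl big_distrr -big_split /=; apply: eq_bigr => i _.
    by rewrite mulrDl mulrA [_ * y * _]mulrAC.
  - move=> i ii0; exists (fun i' => if i' == i then zexp (phi i) (k i 0 - 1) *~ k i 0 else 0).
    rewrite eq_sym (negPf ii0); split=> // j; rewrite (bigD1 i)//= eqxx big1 ?addr0.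
      by rewrite derivation_zexp// mulrzAl.
    by move=> i' /negPf->; rewrite mul0r.
pose c' i := if i == i0 then zexp (phi i0) (k i0 0) *~ (k i0 0 + 1) * X
             else zexp (phi i0) (k i0 0 + 1) * c i.
rewrite -[RHS]/(\det _) (@det_row_combination (\matrix_(i, j) d j (phi i)) i0 c').
- by rewrite /c' eqxx (bigD1 i0)//= -/X !mulrzAl.
- by move=> i j ii0; rewrite !mxE /psi (negPf ii0).
- move=> j; rewrite mxE /psi eqxx dM derivation_zexp// addrK cE.
  rewrite (bigD1 i0)//= [in RHS](bigD1 i0)//= c0 mul0r add0r /c' eqxx mxE; congr (_ + _).
    by rewrite !mulrzAl mulrAC.
  rewrite big_distrr /=; apply: eq_bigr => i /negPf ->.
  by rewrite mxE mulrA.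
Qed.

End Exactness.

(** * Lifting to a torsion-free ring *)

Section LinearExtension.
Variables (K : choiceType) (M : zmodType) (F : K -> M).
Local Notation ZK := {malg int[K]}.

(** The additive extension of F to the free abelian group on K. *)
Definition linext (g : ZK) : M := \sum_(k <- msupp g) F k *~ mcoeff k g.

Lemma linextEw (D : {fset K}) g : (msupp g `<=` D)%fset ->
  linext g = \sum_(k <- D) F k *~ mcoeff k g.
Proof.
move=> gD; rewrite /linext [LHS](big_fset_incl _ gD) => //= x xd.
by move/mcoeff_outdom ->; rewrite mulr0z.
Qed.

Lemma linext_is_zmod_morphism : zmod_morphism linext.
Proof.
move=> g h; pose D := (msupp g `|` msupp h)%fset.
rewrite (@linextEw D) ?msuppB_le// (@linextEw D g) ?fsubsetUl//.
rewrite (@linextEw D h) ?fsubsetUr// -sumrB; apply: eq_bigr => k _.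
by rewrite mcoeffB mulrzBr.
Qed.

HB.instance Definition _ := GRing.isZmodMorphism.Build ZK M linext
  linext_is_zmod_morphism.

Lemma linextU k : linext (mkmalgU k 1) = F k.
Proof.
by rewrite (linextEw (msuppU_le)) big_seq_fset1 mcoeffUU.
Qed.

End LinearExtension.

Lemma linext_funB (K : choiceType) (M : zmodType) (F G : K -> M) (g : {malg int[K]}) :
  linext (fun k => F k - G k) g = linext F g - linext G g.
Proof. by rewrite /linext -sumrB; apply: eq_bigr => k _; rewrite mulrzBl. Qed.

Lemma malg_ind (K : choiceType) (P : {malg int[K]} -> Prop) :
  P 0 -> (forall x y, P x -> P y -> P (x - y)) ->
  (forall k, P (mkmalgU k 1)) -> forall g, P g.
Proof.
move=> P0 PB PU g.
have PN x : P x -> P (- x) by move=> Px; rewrite -sub0r; exact: PB.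
have PD x y : P x -> P y -> P (x + y) by move=> Px /PN; rewrite -[y in X in _ -> X]opprK; exact: PB.
rewrite [g]monalgE; apply: big_ind => // k _.
have PUn (m : nat) : P (mkmalgU k m%:Z).
  elim: m => [|m IH]; first by rewrite monalgU0.
  by rewrite -addn1 PoszD monalgUD; exact: PD.
case: (mcoeff k g) => m //.
by rewrite NegzE monalgUN; exact: PN.
Qed.

(* The integral monoid ring of the multiplicative monoid of [A]: a torsion-free
   ring mapping onto [A], along which units lift to units. *)
Section MonoidRing.
Variable A : comPzRingType.

Definition monring : Type := {malg int[A]}.
HB.instance Definition _ := GRing.Zmodule.on monring.

Definition monU (a : A) : monring := mkmalgU a 1.

Definition monring_mul (x y : monring) : monring :=
  linext (fun a => linext (fun b => monU (a * b)) y) x.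

Lemma monring_mulBl x y z : monring_mul (x - y) z = monring_mul x z - monring_mul y z.
Proof. exact: raddfB. Qed.

Lemma monring_mulBr x y z : monring_mul z (x - y) = monring_mul z x - monring_mul z y.
Proof.
by rewrite /monring_mul -linext_funB; congr (linext _ z); apply: funext => a; rewrite raddfB.
Qed.

Lemma monring_mul0l y : monring_mul 0 y = 0.
Proof. exact: raddf0. Qed.

Lemma monring_mul0r y : monring_mul y 0 = 0.
Proof. by have := monring_mulBr 0 0 y; rewrite !subrr. Qed.

Lemma monring_mulUU a b : monring_mul (monU a) (monU b) = monU (a * b).
Proof. by rewrite /monring_mul !linextU. Qed.

Lemma monring_mulC : commutative monring_mul.
Proof.
elim/malg_ind => [y|x x' IH IH' y|a].
- by rewrite monring_mul0l monring_mul0r.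
- by rewrite monring_mulBl monring_mulBr IH IH'.
elim/malg_ind => [|x x' IH IH'|b].
- by rewrite monring_mul0l monring_mul0r.
- by rewrite monring_mulBl monring_mulBr IH IH'.
by rewrite !monring_mulUU mulrC.
Qed.

Lemma monring_mulA : associative monring_mul.
Proof.
elim/malg_ind => [y z|x x' IH IH' y z|a]; first by rewrite !monring_mul0l.
  by rewrite !monring_mulBl IH IH'.
elim/malg_ind => [z|x x' IH IH' z|b]; first by rewrite monring_mul0r !monring_mul0l monring_mul0r.
  by rewrite !(monring_mulBl, monring_mulBr) IH IH'.
elim/malg_ind => [|x x' IH IH'|c]; first by rewrite !monring_mul0r.
  by rewrite !(monring_mulBl, monring_mulBr) IH IH'.
by rewrite !monring_mulUU mulrA.
Qed.

Lemma monring_mul1 : left_id (monU 1) monring_mul.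
Proof.
elim/malg_ind => [|x x' IH IH'|b]; first by rewrite monring_mul0r.
  by rewrite monring_mulBr IH IH'.
by rewrite monring_mulUU mul1r.
Qed.

Lemma monring_mulDl : left_distributive monring_mul +%R.
Proof.
move=> x y z; have := monring_mulBl (x + y) y z; rewrite addrK => ->.
by rewrite subrK.
Qed.

HB.instance Definition _ := GRing.Zmodule_isComPzRing.Build monring
  monring_mulA monring_mulC monring_mul1 monring_mulDl.

Definition moneval : monring -> A := linext id.
HB.instance Definition _ := GRing.Additive.on moneval.

Lemma moneval_is_monoid_morphism : monoid_morphism moneval.
Proof.
split; first exact: linextU.
elim/malg_ind => [y|x x' IH IH' y|a]; first by rewrite mul0r raddf0 mul0r.
  by rewrite mulrBl !raddfB /= IH IH' mulrBl.
elim/malg_ind => [|x x' IH IH'|b]; first by rewrite mulr0 raddf0 mulr0.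
  by rewrite mulrBr !raddfB /= IH IH' mulrBr.
by rewrite [_ * _]monring_mulUU /moneval !linextU.
Qed.

HB.instance Definition _ := GRing.isMonoidMorphism.Build monring A moneval
  moneval_is_monoid_morphism.

Lemma monevalU a : moneval (monU a) = a.
Proof. exact: linextU. Qed.

Lemma invertible_monU a : invertible a -> invertible (monU a).
Proof.
by move=> [b ab]; exists (monU b); rewrite [LHS]monring_mulUU ab.
Qed.

Lemma monring_torsionfree (x : monring) m : m != 0 -> x *~ m = 0 -> x = 0.
Proof.
move=> m0 xm; apply/malgP => a.
have := congr1 (mcoeff a) xm.
rewrite mcoeff0 raddfMz => /eqP.
by rewrite mulrz_eq0 (negPf m0) => /eqP.
Qed.

End MonoidRing.

Section LexUnits.
Variable A : comPzRingType.

(** The condition defining the value l of nu, with nilpotent coefficients below l strengthened to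
    zero ones, phrased by recursion on the outermost variable. *)
Fixpoint lexunit (n : nat) : 'cV[int]_n -> iterLaurent A n -> Prop :=
  match n return 'cV[int]_n -> iterLaurent A n -> Prop with
  | 0 => fun _ f => invertible f
  | n'.+1 => fun l f => ordge (l ord_max 0) f /\
               lexunit (row' ord_max l) (lcoef f (l ord_max 0))
  end.

Lemma lexunit_invertible n (l : 'cV[int]_n) f : lexunit l f -> invertible f.
Proof.
by elim: n l f => [//|n IH] l f [fl /IH]; exact: invertible_lead.
Qed.

Lemma imap_moneval_lift n (f : iterLaurent A n) :
  exists g : iterLaurent (monring A) n, imap (@moneval A) n g = f.
Proof.
elim: n f => [|n IH] f; first by exists (monU f); exact: monevalU.
have /choice[s sP] := IH.
have [m fm] := lcoef_bound f.
(* Coefficients below m are set to 0 by hand, since the lift chosen for 0 may be nonzero. *)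
have gb : (fun i => if i < m then 0 else s (lcoef f i)) \in @bounded_below (iterLaurent (monring A) n).
  by apply/asboolP; exists m => i ->.
exists (Laurent gb); apply: laurentP => i /=.
by case: ltP => im; rewrite ?sP// raddf0 fm.
Qed.

(** Invertibility is decided by the coefficient at l alone. It is lifted by the multiplicative map
    [monU], the terms below it by 0, and the others arbitrarily. *)
Lemma lexunit_lift n (l : 'cV[int]_n) (f : iterLaurent A n) : lexunit l f ->
  exists2 g : iterLaurent (monring A) n, invertible g & imap (@moneval A) n g = f.
Proof.
elim: n l f => [|n IH] l f.
  by move=> uf; exists (monU f); [exact: invertible_monU|exact: monevalU].
move=> [fm /IH[u iu uE]]; set m := l ord_max 0 in fm uE.
have [g0 g0E] := imap_moneval_lift f.
have gb : (fun i => if i < m then 0 else if i == m then u else lcoef g0 i)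
    \in @bounded_below (iterLaurent (monring A) n).
  by apply/asboolP; exists m => i ->.
exists (Laurent gb).
  by apply: (@invertible_lead _ m) => [i /= ->//|/=]; rewrite ltxx eqxx.
apply: laurentP => i /=; case: ltP => im; first by rewrite raddf0 fm.
by case: eqP => [->//|_]; rewrite -[in RHS]g0E.
Qed.

End LexUnits.

(* Lifting to the monoid ring makes the factor [k i0 + 1] of
   [exact_monomial_jacobian] cancellable. *)
Lemma res_monomial_jacobian (A : comPzRingType) n (phi : 'I_n -> iterLaurent A n)
    (k : 'cV[int]_n) :
  (forall i, exists l, lexunit l (phi i)) -> k != const_mx (-1) ->
  res (mpow phi k * jacobian phi) = 0.
Proof.
move=> uphi kN1.
have [i0 ki0] : exists i, k i 0 != -1.
  apply/existsP; apply: contraNT kN1 => /existsPn H.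
  by apply/eqP/colP => i; rewrite mxE; apply/eqP; have := H i; rewrite negbK.
have /choice[psi psiP] : forall i, exists g : iterLaurent (monring A) n,
    invertible g /\ imap (@moneval A) n g = phi i.
  by move=> i; have [l /lexunit_lift[g ? ?]] := uphi i; exists g.
have ipsi i : invertible (psi i) by case: (psiP i).
have psiE : phi = fun i => imap (@moneval A) n (psi i).
  by apply: funext => i; case: (psiP i).
rewrite psiE -imap_mpow// -imap_jacobian -rmorphM /res icoef_imap.
suff H : res (mpow psi k * jacobian psi) = 0 by rewrite -/(res _) H rmorph0.
have resB : zmod_morphism (@res (monring A) n) by move=> f g; exact: icoefB.
pose rA := GRing.isZmodMorphism.Build _ _ _ resB.
pose rho : {additive iterLaurent (monring A) n -> monring A} := HB.pack (@res (monring A) n) rA.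
apply: (@monring_torsionfree _ _ (k i0 0 + 1)); first by apply: contra ki0 => /eqP ?; lia.
exact: (@exact_monomial_jacobian _ _ _ (@ipartial _ n) rho (@ipartial_derivation _ n)
  (@ipartialC _ n) (@res_ipartial _ n) psi k i0 ipsi).
Qed.

(** * Unconditional sums *)

Section UnconditionalSums.
Variable A : comPzRingType.

(* Sufficient for convergence in the topology of [iterLaurent A n]: the orders
   are uniformly bounded below and, recursively, coefficients are usummable. *)
Fixpoint usum (I : choiceType) (n : nat) : (I -> iterLaurent A n) -> iterLaurent A n -> Prop :=
  match n return (I -> iterLaurent A n) -> iterLaurent A n -> Prop with
  | 0 => fun x f => exists F : {fset I},
           (forall i, i \notin F -> x i = 0) /\ f = \sum_(i <- F) x i
  | n'.+1 => fun x f => (exists m, forall i, ordge m (x i)) /\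
           forall k, usum (fun i => lcoef (x i) k) (lcoef f k)
  end.

Definition usummable (I : choiceType) n (x : I -> iterLaurent A n) := exists f, usum x f.

Lemma usum_ext (I : choiceType) n (x y : I -> iterLaurent A n) f :
  x =1 y -> usum x f -> usum y f.
Proof. by move=> /funext ->. Qed.

Lemma usum_fset_incl (I : choiceType) (x : I -> A) (F G : {fset I}) :
  (F `<=` G)%fset -> (forall i, i \notin F -> x i = 0) ->
  \sum_(i <- F) x i = \sum_(i <- G) x i.
Proof. by move=> FG xF; apply: big_fset_incl => // i _ /xF. Qed.

Lemma usum0 (I : choiceType) n : usum (fun=> 0 : iterLaurent A n) (0 : iterLaurent A n) (I := I).
Proof.
elim: n => [|n IH]; first by exists fset0; split=> //; rewrite big1.
by split=> [|k]; [exists 0|exact: IH].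
Qed.

Lemma usumD (I : choiceType) n (x y : I -> iterLaurent A n) f g :
  usum x f -> usum y g -> usum (fun i => x i + y i) (f + g).
Proof.
elim: n x y f g => [|n IH] x y f g.
  move=> [F [xF ->]] [G [yG ->]]; exists (F `|` G)%fset; split=> [i|].
    by rewrite inE negb_or => /andP[/xF-> /yG->]; rewrite addr0.
  rewrite big_split /=; congr (_ + _).
    by apply: usum_fset_incl => //; exact: fsubsetUl.
  by apply: usum_fset_incl => //; exact: fsubsetUr.
move=> [[m xm] xf] [[m' ym] yg]; split=> [|k]; last first.
  exact: (IH _ _ _ _ (xf k) (yg k)).
exists (Num.min m m') => i.
by apply: ordgeD; [apply: ordgeW (xm i)|apply: ordgeW (ym i)]; rewrite ge_min lexx ?orbT.
Qed.

Lemma usum_sum (I : choiceType) n (J : Type) (r : seq J) (x : J -> I -> iterLaurent A n) f :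
  (forall j, usum (x j) (f j)) ->
  usum (fun i => \sum_(j <- r) x j i) (\sum_(j <- r) f j).
Proof.
move=> xf; elim: r => [|j r IH].
  by rewrite big_nil; apply: usum_ext (usum0 _ _) => i; rewrite big_nil.
by rewrite big_cons; apply: usum_ext (usumD (xf j) IH) => i; rewrite big_cons.
Qed.

Lemma usumMr (I : choiceType) n (x : I -> iterLaurent A n) f h :
  usum x f -> usum (fun i => x i * h) (f * h).
Proof.
elim: n x f h => [|n IH] x f h.
  move=> [F [xF ->]]; exists F; split=> [i /xF->|]; first by rewrite mul0r.
  by rewrite big_distrl.
move=> [[m xm] xf]; have [mh hm] := ordge_exists h; have [mf fm] := ordge_exists f.
split=> [|k]; first by exists (m + mh) => i; exact: ordgeM.
have fm' : ordge (Num.min m mf) f by apply: ordgeW fm; rewrite ge_min lexx orbT.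
have xm' i : ordge (Num.min m mf) (x i) by apply: ordgeW (xm i); rewrite ge_min lexx.
rewrite (lcoefM_win fm' hm (leqnn _)).
apply: usum_ext (usum_sum _ (fun j => IH _ _ (lcoef h (k - j)) (xf j))) => i.
by rewrite (lcoefM_win (xm' i) hm (leqnn _)).
Qed.

Lemma usum_icoef (I : choiceType) n (x : I -> iterLaurent A n) f l :
  usum x f -> @usum I 0 (fun i => icoef (x i) l) (icoef f l).
Proof.
elim: n x f l => [//|n IH] x f l [_ xf].
exact: (IH _ _ (row' ord_max l) (xf (l ord_max 0))).
Qed.

Lemma usum_uniq (I : choiceType) n (x : I -> iterLaurent A n) f g :
  usum x f -> usum x g -> f = g.
Proof.
elim: n x f g => [|n IH] x f g.
  move=> [F [xF ->]] [G [xG ->]].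
  rewrite (@usum_fset_incl _ _ _ (F `|` G)%fset) ?fsubsetUl//.
  by rewrite (@usum_fset_incl _ _ _ (F `|` G)%fset) ?fsubsetUr.
by move=> [_ xf] [_ xg]; apply: laurentP => k; apply: (IH _ _ _ (xf k) (xg k)).
Qed.

Lemma usum_single (I : choiceType) (x : I -> A) (f : A) m :
  @usum I 0 x f -> (forall i, i != m -> x i = 0) -> f = x m.
Proof.
move=> [F [xF ->]] xm.
have -> : \sum_(i <- F) x i = \sum_(i <- (m |` F)%fset) x i.
  by apply: usum_fset_incl => //; exact: fsubsetUr.
rewrite -(@usum_fset_incl _ _ [fset m]%fset) ?big_seq_fset1//.
  by rewrite fsub1set !inE eqxx.
by move=> i; rewrite inE; exact: xm.
Qed.

Lemma usum_push (I J : choiceType) n (q : I -> J) (x : I -> iterLaurent A n)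
    (y : J -> iterLaurent A n) f : injective q ->
  (forall i, y (q i) = x i) -> (forall j, (forall i, j != q i) -> y j = 0) ->
  usum x f -> usum y f.
Proof.
move=> qI; elim: n x y f => [|n IH] x y f yx y0.
  move=> [F [xF ->]]; exists (q @` F)%fset; split=> [j jF|].
    have [[i ji]|nj] := pselect (exists i, j = q i).
      rewrite ji yx xF//; apply: contra jF => iF; rewrite ji; exact: in_imfset.
    by apply: y0 => i; apply/eqP => ji; apply: nj; exists i.
  by rewrite big_imfset => [|i i' _ _ /qI//]; apply: eq_bigr => i _; rewrite yx.
move=> [[m xm] xf]; split=> [|k].
  exists m => j; have [[i ->]|nj] := pselect (exists i, j = q i); first by rewrite yx.
  by rewrite y0 // => i; apply/eqP => ji; apply: nj; exists i.
by apply: IH (xf k) => [i|j jq]; rewrite ?yx// y0.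
Qed.

Lemma usummable_ext (I : choiceType) n (x y : I -> iterLaurent A n) :
  x =1 y -> usummable x -> usummable y.
Proof. by move=> xy [f xf]; exists f; exact: usum_ext xf. Qed.

Lemma usummableS (I : choiceType) n (x : I -> iterLaurent A n.+1) m :
  (forall i, ordge m (x i)) -> (forall k, usummable (fun i => lcoef (x i) k)) ->
  usummable x.
Proof.
move=> xm /choice[s sP].
(* The sums s k come from choice; uniqueness of sums forces them to vanish below m. *)
have sb : s \in @bounded_below (iterLaurent A n).
  apply/asboolP; exists m => k km.
  have H0 : usum (fun i => lcoef (x i) k) 0.
    by have -> : (fun i => lcoef (x i) k) = fun=> 0; [apply: funext => i; rewrite xm|exact: usum0].
  exact: usum_uniq (sP k) H0.
by exists (Laurent sb); split=> //; exists m.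
Qed.

Lemma usummable_coef (I : choiceType) n (x : I -> iterLaurent A n.+1) k :
  usummable x -> usummable (fun i => lcoef (x i) k).
Proof. by move=> [f [_ xf]]; exists (lcoef f k); exact: (xf k). Qed.

Lemma usummable_sum (I : choiceType) n (J : Type) (r : seq J)
    (x : J -> I -> iterLaurent A n) :
  (forall j, usummable (x j)) -> usummable (fun i => \sum_(j <- r) x j i).
Proof. by move=> /choice[f xf]; exists (\sum_(j <- r) f j); exact: usum_sum. Qed.

Lemma usummableMr (I : choiceType) n (x : I -> iterLaurent A n) h :
  usummable x -> usummable (fun i => x i * h).
Proof. by move=> [f xf]; exists (f * h); exact: usumMr. Qed.

(** Summability depends only on where terms vanish, and integer weights preserve zeros. This allows
    the weights of tame families to be moved outside. *)
Lemma usummableMz (I : choiceType) n (x : I -> iterLaurent A n) (e : I -> int) :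
  usummable x -> usummable (fun i => x i *~ e i).
Proof.
have lcoefMz (R : comPzRingType) (u : laurent R) (a k : int) : lcoef (u *~ a) k = lcoef u k *~ a.
  have cB : zmod_morphism (fun u : laurent R => lcoef u k) by [].
  pose cA := GRing.isZmodMorphism.Build _ _ _ cB.
  pose c : {additive laurent R -> R} := HB.pack (fun u : laurent R => lcoef u k) cA.
  exact: (raddfMz c a u).
elim: n x => [|n IH] x.
  move=> [f [F [xF _]]]; exists (\sum_(i <- F) x i *~ e i); exists F; split=> // i /xF->.
  by rewrite mul0rz.
move=> xs; have [f [[m xm] _]] := xs; apply: (@usummableS _ _ _ m) => [i|k].
  by move=> k km; rewrite lcoefMz xm// mul0rz.
by apply: usummable_ext (IH _ (usummable_coef k xs)) => i; rewrite lcoefMz.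
Qed.

Lemma usummable_pull (I J : choiceType) n (q : I -> J) (x : J -> iterLaurent A n) :
  injective q -> usummable x -> usummable (fun i => x (q i)).
Proof.
move=> qI; elim: n x => [|n IH] x.
  move=> [_ [F [xF _]]].
  have [G GP] : exists G : {fset I}, forall i, q i \in F -> i \in G.
    suff H (t : seq J) : exists G : {fset I}, forall i, q i \in t -> i \in G.
      exact: (H (enum_fset F)).
    elim: t => [|j t [G GP]]; first by exists fset0 => i.
    have [[i0 ji]|nj] := pselect (exists i, j = q i).
      exists (i0 |` G)%fset => i; rewrite !inE ji.
      by case/orP => [/eqP/qI->|/GP->]; rewrite ?eqxx ?orbT.
    exists G => i; rewrite !inE => /orP[/eqP ji|/GP//].
    by case: nj; exists i.
  by exists (\sum_(i <- G) x (q i)); exists G; split=> // i iG; apply: xF; apply: contra iG => /GP.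
move=> xs; have [f [[m xm] _]] := xs; apply: (@usummableS _ _ _ m) => // k.
exact: IH (usummable_coef k xs).
Qed.

Section Slices.
Variables (r n : nat).
Implicit Types x : 'cV[int]_r.+1 -> iterLaurent A n.

Lemma colext_inj p : injective (@colext r p).
Proof. by move=> l l' /(congr1 (row' ord_max)); rewrite !row'_colext. Qed.

Lemma usum_slice x p f : usum (fun l => x (colext p l)) f ->
  usum (fun l : 'cV[int]_r.+1 => if l ord_max 0 == p then x l else 0) f.
Proof.
apply: usum_push (@colext_inj p) _ _ => [l|l lp]; first by rewrite colext_max eqxx.
case: eqP => // lmax; have := lp (row' ord_max l).
by rewrite -lmax colextK eqxx.
Qed.

Lemma slices_sum x (s : seq int) : uniq s ->
  (forall l : 'cV[int]_r.+1, l ord_max 0 \notin s -> x l = 0) ->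
  forall l : 'cV[int]_r.+1, \sum_(p <- s) (if l ord_max 0 == p then x l else 0) = x l.
Proof.
move=> us xs l; have [ls|ls] := boolP (l ord_max 0 \in s).
  rewrite (bigD1_seq (l ord_max 0))//= eqxx big1 ?addr0// => p /negPf pl.
  by rewrite eq_sym pl.
rewrite xs// big1_seq// => p _; by case: ifP.
Qed.

Lemma usummable_slices x (s : seq int) : uniq s ->
  (forall l : 'cV[int]_r.+1, l ord_max 0 \notin s -> x l = 0) ->
  (forall p, usummable (fun l => x (colext p l))) -> usummable x.
Proof.
move=> us xs xp; apply: usummable_ext (slices_sum us xs) _.
apply: usummable_sum => p; have [f /usum_slice xf] := xp p; by exists f.
Qed.

(** Sums out the last index. In the specialization at s = 1 it merges, for each exponent of phi, the
    terms coming from different powers of s. *)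
Lemma usum_group x (s : seq int) f : uniq s ->
  (forall l : 'cV[int]_r.+1, l ord_max 0 \notin s -> x l = 0) ->
  usum x f -> usum (fun l => \sum_(p <- s) x (colext p l)) f.
Proof.
move=> us xs xf.
have /choice[g gP] p : usummable (fun l => x (colext p l)).
  by apply: usummable_pull (@colext_inj p) _; exists f.
have -> : f = \sum_(p <- s) g p; last exact: usum_sum.
apply: usum_uniq xf _; apply: usum_ext (slices_sum us xs) _.
by apply: usum_sum => p; exact: usum_slice.
Qed.

End Slices.

Lemma Unbhd_usum (I : choiceType) n (x : I -> iterLaurent A n) f (lam : Lambda n) :
  usum x f -> exists F : {fset I}, forall G : {fset I}, (F `<=` G)%fset ->
    Unbhd lam (\sum_(i <- G) x i - f).
Proof.
elim: n x f lam => [|n IH] x f lam.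
  move=> [F [xF ->]]; exists F => G FG l _.
  by rewrite (usum_fset_incl FG xF) subrr icoef0.
move=> [[m xm] xf].
have [mf fm] := ordge_exists f.
pose m' := Num.min m mf.
have fm' : ordge m' f by apply: ordgeW fm; rewrite ge_min lexx orbT.
have xm' i : ordge m' (x i) by apply: ordgeW (xm i); rewrite ge_min lexx.
have /choice[F FP] k := IH _ _ (lam.1 (- k)) (xf k).
(* Only finitely many exponents of the outermost variable matter: below m' all coefficients vanish,
   and above - lam.2 the neighborhood imposes no condition. *)
pose N := (absz m' + absz lam.2)%N.
exists (\bigcup_(k <- win N) F k)%fset => G FG l Zl; have [l1 l2] : _ /\ _ := Zl.
have [lm|ml] := ltP (l ord_max 0) m'.
  rewrite icoefS lcoefB lcoef_sum fm'// big1 ?subr0 ?icoef0// => i _; exact: xm'.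
rewrite mxE in l1 l2.
have lN : l ord_max 0 \in win N by rewrite mem_win /N; lia.
have FlG : (F (l ord_max 0) `<=` G)%fset.
  by apply: fsubset_trans FG; exact: bigfcup_sup.
rewrite icoefS lcoefB lcoef_sum; apply: (FP _ G FlG).
by move: l2; congr (Zge _ _); apply/colP => i; rewrite !mxE.
Qed.

Lemma usum_sums_to (I : choiceType) n (x : I -> iterLaurent A n) f :
  usum x f -> sums_to x f.
Proof.
move=> xf V [lam _ lamV].
have [F FP] := Unbhd_usum lam xf.
exists F => // G /= FG; apply: lamV => /=.
have -> : partial_sum x G = \sum_(i <- G) x i by rewrite big_seq_fsetE.
exact: FP.
Qed.

End UnconditionalSums.

(** * Systems without nilpotent lower terms *)

(* Families that are finite combinations of fixed ring elements with
   index-dependent integer coefficients.  This is how the powers (1 + y)^l of a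
   fixed y of positive order depend on l, coefficientwise. *)
Section TameFamilies.
Variables (I : Type) (R : comPzRingType).
Implicit Types (u v : I -> R) (U V : I -> laurent R).

Definition tame u := exists s : seq ((I -> int) * R),
  forall i, u i = \sum_(p <- s) p.2 *~ p.1 i.

Lemma tame_ext u v : u =1 v -> tame u -> tame v.
Proof. by move=> /funext->. Qed.

Lemma tame_Mz (c : R) (e : I -> int) : tame (fun i => c *~ e i).
Proof. by exists [:: (e, c)] => i; rewrite big_seq1. Qed.

Lemma tame_const (c : R) : tame (fun=> c).
Proof. by apply: tame_ext (tame_Mz c (fun=> 1)) => i; rewrite mulr1z. Qed.

Lemma tameD u v : tame u -> tame v -> tame (fun i => u i + v i).
Proof. by move=> [s us] [t vt]; exists (s ++ t) => i; rewrite big_cat us vt. Qed.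

Lemma tame_sum (J : Type) (r : seq J) (u : J -> I -> R) :
  (forall j, tame (u j)) -> tame (fun i => \sum_(j <- r) u j i).
Proof.
move=> ut; elim: r => [|j r IH].
  by apply: tame_ext (tame_const 0) => i; rewrite big_nil.
by apply: tame_ext (tameD (ut j) IH) => i; rewrite big_cons.
Qed.

Lemma tameM u v : tame u -> tame v -> tame (fun i => u i * v i).
Proof.
move=> [s us] [t vt].
apply: (@tame_ext (fun i => \sum_(p <- s) \sum_(q <- t) (p.2 * q.2) *~ (p.1 i * q.1 i))) => [i|].
  rewrite us vt big_distrl; apply: eq_bigr => p _; rewrite big_distrr.
  by apply: eq_bigr => q _ /=; rewrite mulrzAl mulrzAr mulrzAC -mulrzA mulrC.
by apply: tame_sum => p; apply: tame_sum => q; exact: tame_Mz.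
Qed.

Definition ltame U := (forall i, ordge 0 (U i)) /\ forall k, tame (fun i => lcoef (U i) k).

Lemma ltame_coefM U G k : ltame U -> tame (fun i => lcoef (U i * G) k).
Proof.
move=> [U0 Ut]; have [m Gm] := ordge_exists G.
apply: tame_ext (_ : tame (fun i => \sum_(j <- win (absz 0%R + absz m + absz k)) lcoef (U i) j * lcoef G (k - j))).
  by move=> i; rewrite (lcoefM_win (U0 i) Gm (leqnn _)).
by apply: tame_sum => j; apply: tameM (tame_const _).
Qed.

Lemma ltame1 : ltame (fun=> 1).
Proof. by split=> [i|k]; [exact: ordge1|exact: tame_const]. Qed.

Lemma ltameM U V : ltame U -> ltame V -> ltame (fun i => U i * V i).
Proof.
move=> [U0 Ut] [V0 Vt]; split=> [i|k]; first by rewrite -[0]addr0; exact: ordgeM.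
apply: tame_ext (_ : tame (fun i => \sum_(j <- win (absz 0%R + absz 0%R + absz k)) lcoef (U i) j * lcoef (V i) (k - j))).
  by move=> i; rewrite (lcoefM_win (U0 i) (V0 i) (leqnn _)).
by apply: tame_sum => j; exact: tameM.
Qed.

Lemma ltame_prod (J : Type) (r : seq J) (U : J -> I -> laurent R) :
  (forall j, ltame (U j)) -> ltame (fun i => \prod_(j <- r) U j i).
Proof.
move=> Ut; elim: r => [|j r IH].
  by rewrite (_ : (fun i => _) = fun=> 1); [exact: ltame1|apply: funext => i; rewrite big_nil].
rewrite (_ : (fun i => _) = fun i => U j i * \prod_(j <- r) U j i); first exact: ltameM.
by apply: funext => i; rewrite big_cons.
Qed.

Lemma ordgeX1 (y : laurent R) (j : nat) : ordge 1 y -> ordge j%:Z (y ^+ j).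
Proof. by move=> y1; have := ordgeX (p := j) y1; rewrite -mulr_natl mulr1 natz. Qed.

(** By the binomial theorem, coefficient k of (1 + y)^e is the sum over j <= |k| of 'C(e, j) times
    that of y^j, because y^j has order at least j. The length of this sum does not depend on e. *)
Lemma ltame_1DX (y : laurent R) (e : I -> nat) : ordge 1 y -> ltame (fun i => (1 + y) ^+ e i).
Proof.
move=> y1; have yj := fun j => ordgeX1 (j := j) y1.
have y0 : ordge 0 (1 + y) by apply: ordgeD; [exact: ordge1|exact: ordgeW y1].
split=> [i|k]; first by have := ordgeX (p := e i) y0; rewrite mul0rn.
pose K := (absz k).+1.
apply: tame_ext (_ : tame (fun i => \sum_(j <- index_iota 0 K) lcoef (y ^+ j) k *~ 'C(e i, j))); last first.
  by apply: tame_sum => j; exact: tame_Mz.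
move=> i; rewrite big_mkord exprDn lcoef_sum.
rewrite (big_ord_widen (maxn K (e i).+1) (fun j => lcoef (y ^+ j) k *~ 'C(e i, j))); last exact: leq_maxl.
rewrite [RHS](eq_bigr (fun j : 'I_(e i).+1 => lcoef (y ^+ j) k *~ 'C(e i, j))); last first.
  move=> j _; rewrite expr1n mul1r -pmulrn.
  by elim: 'C(e i, j) => [|m IH]; rewrite ?mulr0n// !mulrS lcoefD IH.
rewrite [RHS](big_ord_widen (maxn K (e i).+1) (fun j => lcoef (y ^+ j) k *~ 'C(e i, j))); last exact: leq_maxr.
rewrite [LHS]big_mkcond [RHS]big_mkcond; apply: eq_bigr => j _.
case: ltnP => jK; case: ltnP => je //; first by rewrite bin_small// mulr0z.
have kj : k < j%:Z by move: jK; rewrite /K; clear; lia.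
by rewrite (yj j)// mul0rz.
Qed.

Lemma ltame_zexp1D (y : laurent R) (e : I -> int) : ordge 1 y ->
  ltame (fun i => zexp (1 + y) (e i)).
Proof.
move=> y1.
have y0 : ordge 0 (1 + y) by apply: ordgeD; [exact: ordge1|exact: ordgeW y1].
have yl : lcoef (1 + y) 0 = 1 by rewrite lcoefD y1 ?addr0.
have iy : invertible (lcoef (1 + y) 0) by rewrite yl; exact: invertible1.
have [z0 zl] := inverse_ord y0 iy.
pose z := inverse (1 + y) - 1.
have z1 : ordge 1 z.
  move=> i; rewrite -[1]add0r ltzD1 le_eqVlt => /predU1P[->|i0].
    by rewrite lcoefB -[X in lcoef _ X]oppr0 zl yl (inverse_uniq (mulr1 1)) subrr.
  by rewrite lcoefB z0 ?oppr0// lcoef1 lt_eqF// subr0.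
have zE : inverse (1 + y) = 1 + z by rewrite /z [RHS]addrC subrK.
have [P0 Pt] := ltame_1DX (fun i => absz (e i)) y1.
have [N0 Nt] := ltame_1DX (fun i => absz (e i)) z1.
have E i : zexp (1 + y) (e i) =
    if (0 <= e i)%R then (1 + y) ^+ absz (e i) else (1 + z) ^+ absz (e i).
  by case: (e i) => m //=; rewrite zE.
split=> [i|k]; first by rewrite E; case: ifP.
(* The indicators of e i >= 0 and e i < 0 are integer weights too, which merges the two signs into a
   single tame family. *)
apply: tame_ext (_ : tame (fun i => lcoef ((1 + y) ^+ absz (e i)) k * (1 *~ Posz (0 <= e i)%R) +
   lcoef ((1 + z) ^+ absz (e i)) k * (1 *~ Posz (~~ (0 <= e i)%R)))); last first.
  apply: tameD; apply: tameM => //; exact: tame_Mz.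
by move=> i; rewrite E; case: ifP => _ /=; rewrite mulr1z mulr0z mulr1 mulr0 ?addr0 ?add0r.
Qed.

End TameFamilies.

Section LexRegular.
Variable A : comPzRingType.

Definition lead0 n (phi : 'I_n.+1 -> iterLaurent A n.+1) (i : 'I_n) : iterLaurent A n :=
  lcoef (phi (lift ord_max i)) 0.

(* Systems whose exponent matrix is upper unitriangular, with no nilpotent
   terms below the leading exponents. *)
Fixpoint lexreg n : ('I_n -> iterLaurent A n) -> Prop :=
  match n return ('I_n -> iterLaurent A n) -> Prop with
  | 0 => fun _ => True
  | n'.+1 => fun phi => [/\ forall i, ordge 0 (phi (lift ord_max i)),
       ordge 1 (phi ord_max),
       exists l, lexunit l (lcoef (phi ord_max) 1 : iterLaurent A n') &
       lexreg (lead0 phi)]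
  end.

Lemma lexreg_lexunit n (phi : 'I_n -> iterLaurent A n) : lexreg phi ->
  forall i, exists l, lexunit l (phi i).
Proof.
elim: n phi => [phi _ []//|n IH] phi [phi0 phi1 [lu ul] /IH reg] i.
have [j ->|->] := unliftP ord_max i.
  by have [l ll] := reg j; exists (colext 0 l); rewrite /= colext_max row'_colext.
by exists (colext 1 lu); rewrite /= colext_max row'_colext.
Qed.

Lemma lexreg_invertible n (phi : 'I_n -> iterLaurent A n) : lexreg phi ->
  forall i, invertible (phi i).
Proof. by move=> /lexreg_lexunit reg i; have [l /lexunit_invertible] := reg i. Qed.

Lemma mpow_colext n (phi : 'I_n.+1 -> iterLaurent A n.+1) p (l : 'cV[int]_n) :
  mpow phi (colext p l) =
  (\prod_(i < n) zexp (phi (lift ord_max i)) (l i 0)) * zexp (phi ord_max) p.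
Proof.
rewrite /mpow big_ord_recr /= colext_max; congr (_ * _); apply: eq_bigr => i _.
have -> : widen_ord (leqnSn n) i = lift ord_max i by apply: val_inj; rewrite /= /bump leqNgt ltn_ord.
by rewrite colext_lift.
Qed.

Section Step.
Variables (n : nat) (phi : 'I_n.+1 -> iterLaurent A n.+1).
Hypothesis reg : lexreg phi.
Let u := lcoef (phi ord_max) 1.

Lemma lexreg_lead_invertible : invertible u.
Proof. by have [_ _ [l /lexunit_invertible]] := reg. Qed.

Lemma lead0_reg : lexreg (lead0 phi).
Proof. by have [] := reg. Qed.

Lemma lead0_invertible i : invertible (lead0 phi i).
Proof. exact: lexreg_invertible lead0_reg i. Qed.

Lemma zexp_max_ord p : ordge p (zexp (phi ord_max) p) /\
  lcoef (zexp (phi ord_max) p) p = zexp u p.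
Proof.
have [_ phi1 _ _] := reg; have := zexp_ord p phi1 lexreg_lead_invertible.
by rewrite mul1r.
Qed.

Lemma prod_lift_ord (l : 'cV[int]_n) :
  ordge 0 (\prod_(i < n) zexp (phi (lift ord_max i)) (l i 0)) /\
  lcoef (\prod_(i < n) zexp (phi (lift ord_max i)) (l i 0)) 0 = mpow (lead0 phi) l.
Proof.
have [phi0 _ _ _] := reg.
have z i : ordge 0 (zexp (phi (lift ord_max i)) (l i 0)) /\
    lcoef (zexp (phi (lift ord_max i)) (l i 0)) 0 = zexp (lead0 phi i) (l i 0).
  by have := zexp_ord (l i 0) (phi0 i) (lead0_invertible i); rewrite mul0r.
split; first by apply: ordge_prod => i _; case: (z i).
by rewrite lead_prod => [|i]; [apply: eq_bigr => i _|]; case: (z i).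
Qed.

Lemma mpow_ord p (l : 'cV[int]_n) :
  ordge p (mpow phi (colext p l)) /\
  lcoef (mpow phi (colext p l)) p = mpow (lead0 phi) l * zexp u p.
Proof.
rewrite mpow_colext; have [P0 Pl] := prod_lift_ord l; have [Z0 Zl] := zexp_max_ord p.
rewrite -[X in ordge X]add0r -[X in lcoef _ X]add0r.
by split; [exact: ordgeM|rewrite leadM// Pl Zl].
Qed.

Lemma det_ord m (M : 'M[laurent (iterLaurent A n)]_m) : (forall i j, ordge 0 (M i j)) ->
  ordge 0 (\det M) /\ lcoef (\det M) 0 = \det (map_mx (fun f => lcoef f 0) M).
Proof.
move=> M0; split.
  apply: ordge_sum => s _; rewrite mulr_sign.
  by case: odd_perm; [apply: ordgeN|]; apply: ordge_prod.
rewrite lcoef_sum; apply: eq_bigr => s _; rewrite !mulr_sign.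
by case: odd_perm; rewrite ?lcoefN lead_prod//; [congr (- _)|]; apply: eq_bigr => i _; rewrite mxE.
Qed.

(** At t_n = 0 the last row reduces to its last entry u, because the other partial derivatives of
    phi_n keep order 1; the minor that remains is the Jacobian matrix of [lead0 phi]. *)
Lemma jacobian_ord : ordge 0 (jacobian phi) /\
  lcoef (jacobian phi) 0 = jacobian (lead0 phi) * u.
Proof.
have [phi0 phi1 _ _] := reg.
have M0 (i j : 'I_n.+1) : ordge 0 ((\matrix_(i, j) ipartial j (phi i)) i j).
  rewrite mxE /=; case: unliftP => [j' _|_].
    apply: lmap_ordge; have [i' ->|->] := unliftP ord_max i; first exact: phi0.
    exact: ordgeW phi1.
  move=> k k0; rewrite lcoef_lderiv.
  have [i' ->|->] := unliftP ord_max i; last by rewrite phi1 ?mul0rz//; lia.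
  (* A derivative in t_n of a series of order 0 could start at t_n^(-1), but there the factor k + 1
     is 0. *)
  have [k1|k1] := eqVneq k (-1); first by rewrite k1 addNr mulr0z.
  by rewrite phi0 ?mul0rz//; lia.
have [J0 ->] := det_ord M0; split=> //.
rewrite (expand_det_row _ ord_max) (bigD1 ord_max)//= big1 ?addr0; last first.
  move=> j jmax; rewrite !mxE; case: unliftP jmax => [j' _ _|->]; last by rewrite eqxx.
  by rewrite lcoef_lmap phi1// raddf0 mul0r.
rewrite !mxE unlift_none lcoef_lderiv add0r mulr1z mulrC; congr (_ * _).
rewrite /cofactor addnn -signr_odd odd_double expr0 mul1r; congr (\det _).
by apply/matrixP => i j; rewrite !mxE liftK lcoef_lmap.
Qed.

End Step.

Lemma jacobian_invertible n (phi : 'I_n -> iterLaurent A n) : lexreg phi ->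
  invertible (jacobian phi).
Proof.
elim: n phi => [|n IH] phi reg; first by rewrite /jacobian det_mx00; exact: invertible1.
have [J0 Jl] := jacobian_ord reg; apply: invertible_lead J0 _; rewrite Jl.
by apply: invertibleM (lexreg_lead_invertible reg); apply/IH/lead0_reg.
Qed.

Lemma mpow_row n (phi : 'I_n.+1 -> iterLaurent A n.+1) (l : 'cV[int]_n.+1) :
  mpow phi l = mpow phi (colext (l ord_max 0) (row' ord_max l)).
Proof. by rewrite colextK. Qed.

Lemma resS n (f : iterLaurent A n.+1) : res f = res (lcoef f (-1)).
Proof. by rewrite /res icoefS mxE row'_const. Qed.

(** This is the residue of the product of the logarithmic forms d phi_i / phi_i. The u^(-1) from the
    power of phi_n cancels the u in the lowest coefficient of the Jacobian, leaving the same residue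
    for [lead0 phi]. *)
Lemma res_jacobian_dlog n (phi : 'I_n -> iterLaurent A n) : lexreg phi ->
  res (mpow phi (const_mx (-1)) * jacobian phi) = 1.
Proof.
elim: n phi => [|n IH] phi reg.
  by rewrite /res /= /mpow big_ord0 mul1r /jacobian det_mx00.
have [J0 Jl] := jacobian_ord reg.
rewrite mpow_row mxE row'_const resS.
have [P0 Pl] := mpow_ord reg (-1) (const_mx (-1)).
rewrite -[X in lcoef _ X]addr0 leadM// Pl Jl.
rewrite mulrACA zexpN1 [inverse _ * _]mulrC mulr_inverse ?mulr1; first exact: IH (lead0_reg reg).
exact: lexreg_lead_invertible.
Qed.

Lemma res_mpow_jacobian n (phi : 'I_n -> iterLaurent A n) k : lexreg phi ->
  res (mpow phi k * jacobian phi) = (k == const_mx (-1))%:R.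
Proof.
move=> reg; case: eqVneq => [->|k1]; first by rewrite res_jacobian_dlog.
by rewrite res_monomial_jacobian//; exact: lexreg_lexunit.
Qed.

(** If g has order at least p, multiplication by phi_n^(-p-1) moves its coefficient at p to degree
    -1, where the residue sees it. The induction hypothesis kills that coefficient, so the order of
    g can be raised forever. *)
Lemma mpow_nondegenerate n (phi : 'I_n -> iterLaurent A n) (g : iterLaurent A n) :
  lexreg phi -> (forall k, res (g * mpow phi k) = 0) -> g = 0.
Proof.
elim: n phi g => [|n IH] phi g reg gk.
  by have := gk 0; rewrite mpow0 mulr1.
have [m gm] := ordge_exists g.
apply: ordge_eq0 => N.
suff H (j : nat) : ordge (m + j%:Z) g.
  by apply: ordgeW (H (absz (N%:Z - m))); lia.
elim: j => [|j IHj]; first by rewrite addr0.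
set p := m + j%:Z in IHj.
move=> i ip; have [?|pi] := ltP i p; first exact: IHj.
have -> : i = p by rewrite /p; lia.
have iu := lexreg_lead_invertible reg.
suff E : lcoef g p * zexp (lcoef (phi ord_max) 1) (- p - 1) = 0.
  have := congr1 (fun z => z * inverse (zexp (lcoef (phi ord_max) 1) (- p - 1))) E.
  by rewrite -mulrA mulr_inverse ?mulr1 ?mul0r//; exact: invertible_zexp.
apply: (IH _ _ (lead0_reg reg)) => k.
have := gk (colext (- p - 1) k); rewrite resS.
have [P0 Pl] := mpow_ord reg (- p - 1) k.
have pE : -1 = p + (- p - 1) by lia.
rewrite [X in lcoef _ X]pE leadM// Pl [mpow _ _ * _]mulrC mulrA.
exact.
Qed.

(** For i < n, phi_i is its leading coefficient times 1 + y_i with y_i of positive order; W l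
    collects the powers (1 + y_i)^(l_i). Tameness is stated along any e because W is needed at l and
    at - l - 1. *)
Lemma prod_lift_tame n (phi : 'I_n.+1 -> iterLaurent A n.+1) : lexreg phi ->
  exists W : 'cV[int]_n -> laurent (iterLaurent A n),
    (forall l : 'cV[int]_n, \prod_(i < n) zexp (phi (lift ord_max i)) (l i 0) =
       lconst (mpow (lead0 phi) l) * W l) /\
    forall (I : Type) (e : I -> 'cV[int]_n), ltame (fun i => W (e i)).
Proof.
move=> reg; have [phi0 _ _ _] := reg.
pose y i := lconst (inverse (lead0 phi i)) * phi (lift ord_max i) - 1.
have y1 i : ordge 1 (y i).
  move=> k; rewrite -[1]add0r ltzD1 le_eqVlt lcoefB lcoef_lconstM lcoef1 => /predU1P[->|k0].
    by rewrite -/(lead0 _ _) mulrC mulr_inverse ?subrr//; exact: lead0_invertible.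
  by rewrite phi0// mulr0 lt_eqF// subr0.
have yE i : phi (lift ord_max i) = lconst (lead0 phi i) * (1 + y i).
  rewrite addrC subrK mulrA -rmorphM mulr_inverse ?rmorph1 ?mul1r//; exact: lead0_invertible.
have iy i : invertible (1 + y i).
  by rewrite -[y i]opprK; apply: invertible1B; exact: ordgeN.
exists (fun l => \prod_i zexp (1 + y i) (l i 0)); split=> [l|I e].
  rewrite rmorph_prod -big_split; apply: eq_bigr => i _ /=.
  rewrite yE zexpM//; last by apply: rmorph_invertible; exact: lead0_invertible.
  by rewrite rmorph_zexp//; exact: lead0_invertible.
by apply: ltame_prod => i; exact: ltame_zexp1D.
Qed.

(** For a fixed exponent p of phi_n, the coefficient of phi^l and the argument of the residue are
    powers of [lead0 phi] times tame families. Expanding both gives a finite integer-weighted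
    combination of families of the same kind in n - 1 variables. The series H is arbitrary because
    it changes in this reduction. *)
Lemma usummable_residues n (phi : 'I_n -> iterLaurent A n) (H : iterLaurent A n) :
  lexreg phi ->
  usummable (fun l => iconst n (res (H * mpow phi (- l - const_mx 1))) * mpow phi l).
Proof.
elim: n phi H => [|n IH] phi H reg.
  exists (\sum_(i <- [fset 0]%fset) iconst 0 (res (H * mpow phi (- i - const_mx 1))) * mpow phi i).
  by exists [fset 0]%fset; split=> // i; rewrite inE => /negP[]; apply/eqP/colP; case.
have [m Hm] := ordge_exists H.
have colN p (l : 'cV[int]_n) : - colext p l - const_mx 1 = colext (- p - 1) (- l - const_mx 1).
  by apply/colP => i; rewrite !mxE; case: unliftP => [j _|_]; rewrite ?mxE.
(* The argument of the residue has order at least m - p - 1, which exceeds -1. *)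
have c0 p l : p < m -> res (H * mpow phi (- colext p l - const_mx 1)) = 0.
  move=> pm; have [P0 _] := mpow_ord reg (- p - 1) (- l - const_mx 1).
  by rewrite colN resS (ordgeM Hm P0); [exact: icoef0|lia].
apply: (@usummableS _ _ _ _ m) => [l|k].
  rewrite -[l]colextK; set p := l ord_max 0; set l' := row' _ _.
  have [pm|pm] := ltP p m; first by rewrite c0// rmorph0 mul0r.
  have [P0 _] := mpow_ord reg p l'; move=> i im.
  by rewrite [iconst _ _]/= lcoef_lconstM P0 ?mulr0//; exact: lt_le_trans pm.
have lE (c : A) (F : iterLaurent A n.+1) : lcoef (iconst n.+1 c * F) k = iconst n c * lcoef F k.
  by rewrite [iconst _ _]/= lcoef_lconstM.
(* Only slices with m <= p <= k reach coefficient k: the residue vanishes for p < m, and phi^l has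
   order at least p. *)
apply: (@usummable_slices _ _ _ _ (win (absz m + absz k))); first exact: fset_uniq.
  move=> l; rewrite mem_win lE -[l]colextK colext_max.
  set p := l ord_max 0; set l' := row' _ _ => lw.
  have [pm|pm] := ltP p m; first by rewrite c0// rmorph0 mul0r.
  by have [P0 _] := mpow_ord reg p l'; rewrite P0 ?mulr0//; lia.
move=> p; have [W [WE Wt]] := prod_lift_tame reg.
have [s sE] := ltame_coefM (zexp (phi ord_max) p) k (Wt _ id).
have [t tE] := ltame_coefM (H * zexp (phi ord_max) (- p - 1)) (-1)
  (Wt _ (fun l => - l - const_mx 1)).
apply: (@usummable_ext _ _ _ (fun l => \sum_(q <- s) \sum_(q' <- t)
   ((iconst n (res (q'.2 * mpow (lead0 phi) (- l - const_mx 1))) * mpow (lead0 phi) l) * q.2)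
     *~ (q.1 l * q'.1 l))); last first.
  apply: usummable_sum => q; apply: usummable_sum => q'.
  by apply/usummableMz/usummableMr/IH/lead0_reg.
move=> l; rewrite lE mpow_colext WE -mulrA lcoef_lconstM sE.
rewrite colN mpow_colext WE resS -mulrA.
have -> : H * (lconst (mpow (lead0 phi) (- l - const_mx 1)) *
      (W (- l - const_mx 1) * zexp (phi ord_max) (- p - 1))) =
    lconst (mpow (lead0 phi) (- l - const_mx 1)) *
      (W (- l - const_mx 1) * (H * zexp (phi ord_max) (- p - 1))).
  by ring.
rewrite lcoef_lconstM tE !big_distrr /=; apply: eq_bigr => q _.
rewrite res_sum rmorph_sum big_distrl /=; apply: eq_bigr => q' _.
have resMz (x : iterLaurent A n) a : res (x *~ a) = res x *~ a.
  have resB : zmod_morphism (@res A n) by move=> f g; exact: icoefB.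
  pose rA := GRing.isZmodMorphism.Build _ _ _ resB.
  pose rho : {additive iterLaurent A n -> A} := HB.pack (@res A n) rA.
  exact: (raddfMz rho a x).
rewrite !mulrzAr resMz raddfMz mulrzAl -mulrzA.
by rewrite [mpow _ _ * q'.2]mulrC -mulrA [in RHS](mulrC (q'.1 l)).
Qed.

Lemma lexreg_expansion n (phi : 'I_n -> iterLaurent A n) (f : iterLaurent A n) :
  lexreg phi ->
  usum (fun l => iconst n (res (f * mpow phi (- l - const_mx 1) * jacobian phi)) * mpow phi l) f.
Proof.
move=> reg; have iphi := lexreg_invertible reg; have [J' JJ'] := jacobian_invertible reg.
set x := fun l => _.
have xE : (fun l => iconst n (res (f * jacobian phi * mpow phi (- l - const_mx 1))) * mpow phi l) = x.
  by apply: funext => l; rewrite /x mulrAC.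
have [F xF] : usummable x by rewrite -xE; exact: usummable_residues.
suff -> : f = F by [].
apply/eqP; rewrite -subr_eq0; apply/eqP.
suff gJ : (f - F) * jacobian phi = 0 by rewrite -[f - F]mulr1 -JJ' mulrA gJ mul0r.
apply: (mpow_nondegenerate reg) => k.
(* By orthogonality, m is the only index whose term survives pairing with J phi^k, since phi^m phi^k
   = phi^(-1). *)
pose m := - k - const_mx 1.
have km : k = - m - const_mx 1 by rewrite /m opprB opprK addrAC subrr add0r.
have := usum_icoef (const_mx (-1)) (usumMr (jacobian phi * mpow phi k) xF).
have orth l : icoef (x l * (jacobian phi * mpow phi k)) (const_mx (-1)) =
    res (f * mpow phi (- l - const_mx 1) * jacobian phi) * (l == m)%:R.
  rewrite /x -mulrA icoef_iconstM; congr (_ * _).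
  rewrite [jacobian _ * _]mulrC mulrA -mpowD// -/(res _) res_mpow_jacobian//.
  congr (_%:R); rewrite km addrA -[X in _ == X]add0r.
  have -> : (const_mx (-1) : 'cV[int]_n) = - const_mx 1 by apply/colP => i; rewrite !mxE.
  by rewrite (inj_eq (addIr _)) subr_eq0.
move=> /(@usum_single _ _ _ _ m) E.
rewrite mulrBl mulrBl /res icoefB.
rewrite -[F * _ * _]mulrA E => [|l lm]; rewrite orth; last by rewrite (negPf lm) mulr0.
by rewrite eqxx mulr1 -km -/(res _) mulrAC subrr.
Qed.

End LexRegular.

(** * Nilpotent parts of invertible series *)

Definition spec_mem (A : comPzRingType) (P : Spec A) : A -> Prop := spec_ideal P.
Coercion spec_mem : Spec >-> Funclass.

Section Nilradical.
Variable R : comPzRingType.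
Implicit Types (x y : R) (P : Spec R).

Lemma spec0 P : P 0. Proof. by have [] := specP P. Qed.
Lemma specD P x y : P x -> P y -> P (x + y).
Proof. by have [_ + _ _ _] := specP P; exact. Qed.
Lemma specMl P x y : P y -> P (x * y).
Proof. by have [_ _ + _ _] := specP P; exact. Qed.
Lemma specMr P x y : P x -> P (x * y).
Proof. by rewrite mulrC; exact: specMl. Qed.
Lemma spec1 P : ~ P 1. Proof. by have [] := specP P. Qed.
Lemma specM P x y : P (x * y) -> P x \/ P y.
Proof. by have [_ _ _ _] := specP P; exact. Qed.
Lemma specN P x : P x -> P (- x).
Proof. by rewrite -mulN1r; exact: specMl. Qed.
Lemma spec_sum P (I : Type) (r : seq I) (C : pred I) (F : I -> R) :
  (forall i, C i -> P (F i)) -> P (\sum_(i <- r | C i) F i).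
Proof. by move=> PF; apply: big_ind => //; [exact: spec0|exact: specD]. Qed.
Lemma spec_addl P x y : P x -> P (x + y) -> P y.
Proof. by move=> /specN Px Pxy; rewrite -(addKr x y); exact: specD. Qed.

Lemma spec_nilpotent P x : nilpotent x -> P x.
Proof.
move=> [k]; elim: k => [|k IH]; first by rewrite expr0 => r0; rewrite -[x]mulr1 r0 mulr0; exact: spec0.
move=> xk; have : P (x ^+ k.+1) by rewrite xk; exact: spec0.
elim: k {IH xk} => [|k IH]; first by rewrite expr1.
by rewrite exprS => /specM[].
Qed.

Lemma exists_prime x : ~ nilpotent x -> exists P : Spec R, ~ P x.
Proof.
move=> nx.
pose closed_avoiding (J : set R) := [/\ forall a b, J a -> J b -> J (a + b),
  forall a b, J b -> J (a * b) & forall k, ~ J (x ^+ k)].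
have [|I [[ID IM Ix] Imax]] := @Zorn_bigcup R closed_avoiding.
  move=> C CP Ctot; split.
  - move=> a b [J CJ Ja] [L CL Lb]; have [JL|LJ] := Ctot J L CJ CL.
      by exists L => //; have [D _ _] := CP L CL; apply: D => //; exact: JL.
    by exists J => //; have [D _ _] := CP J CJ; apply: D => //; exact: LJ.
  - by move=> a b [J CJ Jb]; exists J => //; have [_ M _] := CP J CJ; exact: M.
  - by move=> k [J CJ]; have [_ _] := CP J CJ; exact.
have I0 : I 0.
  apply: contrapT => nI0; apply: (Imax [set 0]%classic).
    split; last by move=> /(_ 0 erefl).
    by move=> a Ia; case: nI0; rewrite -(mul0r a); exact: IM.
  split=> [a b -> ->|a b ->|k xk]; rewrite ?addr0 ?mulr0//.
  by apply: nx; exists k.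
pose adj a := [set z | exists i b, I i /\ z = i + b * a]%classic.
have adj_x a : ~ I a -> exists k, adj a (x ^+ k).
  move=> nIa; apply: contrapT => nk; apply: (Imax (adj a)).
    split; first by move=> i Ii; exists i, 0; rewrite mul0r addr0.
    by move=> H; apply: nIa; apply: H; exists 0, 1; rewrite mul1r add0r.
  split=> [_ _ [i [b [Ii ->]]] [j [c [Ij ->]]]|c _ [i [b [Ii ->]]]|k ak].
  - by exists (i + j), (b + c); split; [exact: ID|rewrite mulrDl addrACA].
  - by exists (c * i), (c * b); split; [exact: IM|rewrite mulrDr mulrA].
  - by apply: nk; exists k.
have prI : prime_ideal I.
  split=> //; first by have := Ix 0%N.
  move=> a b Iab; apply: contrapT => /not_orP[/adj_x[k [i [c [Ii xk]]]] /adj_x[m [j [d [Ij xm]]]]].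
  apply: (Ix (k + m)%N); rewrite exprD xk xm mulrDl.
  have I1 : I (i * (j + d * b)) by rewrite mulrC; exact: IM Ii.
  have I2 : I (c * a * j) by exact: IM Ij.
  have I3 : I (c * a * (d * b)) by rewrite mulrACA; exact: IM Iab.
  by rewrite [c * a * _]mulrDr; exact: (ID _ _ I1 (ID _ _ I2 I3)).
by exists (MkSpec prI) => xI; have := Ix 1%N; rewrite expr1.
Qed.

Lemma nilpotentP x : (forall P : Spec R, P x) -> nilpotent x.
Proof. by move=> xP; apply: contrapT => /exists_prime[P]; exact. Qed.

Lemma nilpotentD x y : nilpotent x -> nilpotent y -> nilpotent (x + y).
Proof.
by move=> nx ny; apply: nilpotentP => P; apply: specD; exact: spec_nilpotent.
Qed.

Lemma nilpotentMr x y : nilpotent x -> nilpotent (x * y).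
Proof. by move=> [k xk]; exists k; rewrite exprMn xk mul0r. Qed.

Lemma nilpotent_sum (I : Type) (r : seq I) (C : pred I) (F : I -> R) :
  (forall i, C i -> nilpotent (F i)) -> nilpotent (\sum_(i <- r | C i) F i).
Proof.
by move=> nF; apply: big_ind => //; [exists 1; rewrite expr1|exact: nilpotentD].
Qed.

Lemma comaximal_pow x y (m n : nat) : x + y = 1 ->
  exists p q, x ^+ m * p + y ^+ n * q = 1.
Proof.
have step (a b : R) k p q : a + b = 1 -> a ^+ k * p + b * q = 1 ->
    exists p' q', a ^+ k.+1 * p' + b * q' = 1.
  move=> ab1 E; exists p, (a ^+ k * p + q).
  by rewrite -[RHS]E -{2}[a ^+ k * p]mul1r -ab1 exprS; ring.
move=> xy.
have [p [q E]] : exists p q, x ^+ m * p + y * q = 1.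
  elim: m => [|m [p [q E]]]; first by exists 1, 0; rewrite expr0 mulr0 addr0 mulr1.
  exact: step E.
elim: n => [|n [p' [q' E']]]; first by exists 0, 1; rewrite mulr0 add0r expr0 mulr1.
exists (p * (y ^+ n * q') + p'), (q * q').
rewrite -[RHS]E' -[X in _ = _ + X]mul1r -E exprS; ring.
Qed.

Lemma invertible1B_nilpotent x : nilpotent x -> invertible (1 - x).
Proof.
move=> [k xk]; have [p [q]] := @comaximal_pow (1 - x) x 1 k (subrK _ _).
by rewrite xk mul0r addr0 expr1; exists p.
Qed.

Lemma idempotent_nilpotent x : x * x = x -> nilpotent x -> x = 0.
Proof.
move=> xx [k xk]; have xE (m : nat) : x ^+ m.+1 = x.
  by elim: m => [|m IH]; rewrite ?expr1// exprS IH.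
by rewrite -(xE k) exprS xk mulr0.
Qed.

End Nilradical.

Lemma int_min (Q : int -> Prop) m : (forall i, i < m -> ~ Q i) -> (exists k, Q k) ->
  exists k, Q k /\ forall i, i < k -> ~ Q i.
Proof.
move=> Qm [k Qk].
have ex : exists j : nat, `[< Q (m + j%:Z) >].
  exists (absz (k - m)); apply/asboolP; have [/Qm//|mk] := ltP k m.
  by rewrite (_ : m + _ = k)//; lia.
case: (ex_minnP ex) => j /asboolP Qj jmin; exists (m + j%:Z); split=> // i ij.
have [/Qm//|mi] := ltP i m; move=> Qi.
have := jmin (absz (i - m)).
rewrite (_ : m + (absz (i - m))%:Z = i); last by lia.
by move/asboolP in Qi => /(_ Qi); lia.
Qed.

Section LaurentPrimes.
Variables (B : comPzRingType) (P : Spec B).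
Implicit Types f g : laurent B.

(** Modulo P the lowest terms of f and g sit at i and j, so a single term of the convolution at i +
    j survives. *)
Lemma lead_mod_prime f g i j :
  (forall a, a < i -> P (lcoef f a)) -> ~ P (lcoef f i) ->
  (forall a, a < j -> P (lcoef g a)) -> ~ P (lcoef g j) ->
  ~ P (lcoef (f * g) (i + j)).
Proof.
move=> fi nfi gj ngj.
have [mf fm] := ordge_exists f; have [mg gm] := ordge_exists g.
pose N := (absz mf + absz mg + absz (i + j)%R + absz i)%N.
rewrite (@lcoefM_win _ _ _ _ _ _ N fm gm); last exact: leq_addr.
have iN : i \in win N by rewrite mem_win /N; lia.
rewrite (bigD1_seq i) ?fset_uniq//=.
move=> Pfg; have : P (lcoef f i * lcoef g (i + j - i)).
  move: Pfg; rewrite addrC; apply: spec_addl; apply: spec_sum => a ai.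
  have [lai|] := ltP a i; first by apply/specMr/fi.
  by move=> ia; apply/specMl/gj; move: ai ia; lia.
by rewrite addrAC subrr add0r => /specM[].
Qed.

Lemma lead_mod_exists f : (exists k, ~ P (lcoef f k)) ->
  exists i, ~ P (lcoef f i) /\ forall a, a < i -> P (lcoef f a).
Proof.
move=> nf; have [m fm] := ordge_exists f.
have [k km|i [nfi fi]] := @int_min (fun k => ~ P (lcoef f k)) m _ nf.
  by rewrite fm//; apply; exact: spec0.
by exists i; split=> // a /fi /contrapT.
Qed.

Lemma laurent_prime : prime_ideal [set f : laurent B | forall k, P (lcoef f k)]%classic.
Proof.
split.
- by move=> k; exact: spec0.
- by move=> f g fP gP k; exact: specD (fP k) (gP k).
- move=> f g gP k; have [mf fm] := ordge_exists f; have [mg gm] := ordge_exists g.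
  rewrite -/(lcoef (f * g) k) (lcoefM_win fm gm (leqnn _)); apply: spec_sum => i _; exact: specMl (gP _).
- by move=> /(_ 0); exact: spec1.
move=> f g fgP; apply: contrapT => /not_orP[/existsNP /lead_mod_exists[i [nfi fi]]].
move=> /existsNP /lead_mod_exists[j [ngj gj]].
exact: lead_mod_prime fi nfi gj ngj (fgP _).
Qed.

End LaurentPrimes.

(** Modulo any prime, the lowest exponents of f and g add up to 0. If i + j < 0, then i or j lies
    below the corresponding one. *)
Lemma laurent_unit_nilpotent (B : comPzRingType) (f g : laurent B) i j :
  f * g = 1 -> i + j < 0 -> nilpotent (lcoef f i * lcoef g j).
Proof.
move=> fg ij; apply: nilpotentP => P.
pose Q := MkSpec (laurent_prime P).
have nQ : ~ Q (f * g) by rewrite fg; exact: spec1.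
have [i0 [nfi fi]] : exists i, ~ P (lcoef f i) /\ forall a, a < i -> P (lcoef f a).
  by apply: lead_mod_exists; apply/existsNP => fQ; apply: nQ; exact: specMr.
have [j0 [ngj gj]] : exists i, ~ P (lcoef g i) /\ forall a, a < i -> P (lcoef g a).
  by apply: lead_mod_exists; apply/existsNP => gQ; apply: nQ; exact: specMl.
have := lead_mod_prime fi nfi gj ngj; rewrite fg lcoef1.
case: eqP => [ij0 _|_ []]; last exact: spec0.
have [ii|ii] := ltP i i0; first by apply/specMr/fi.
by apply/specMl/gj; lia.
Qed.

Section NilpotentParts.
Variable A : comPzRingType.

Lemma iterLaurent_prime n (P : Spec A) :
  exists Q : Spec (iterLaurent A n), forall f, Q f <-> forall l, P (icoef f l).
Proof.
elim: n => [|n [Q QP]].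
  by exists P => f; split=> [//|/(_ 0)].
exists (MkSpec (laurent_prime Q)) => f; split=> [fQ l|fP k].
  exact: (proj1 (QP _) (fQ (l ord_max 0))).
by apply/(QP (lcoef f k)) => l; have := fP (colext k l); rewrite icoefS colext_max row'_colext.
Qed.

Lemma nilpotent_icoefMr n (u v : iterLaurent A n) :
  (forall l, nilpotent (icoef u l)) -> forall l, nilpotent (icoef (u * v) l).
Proof.
move=> nu l; apply: nilpotentP => P; have [Q QP] := iterLaurent_prime n P.
by apply: (proj1 (QP _)); apply/specMr/QP => k; exact: spec_nilpotent.
Qed.

(** Idempotent lifting: a power of u agrees up to a factor with an idempotent e of the ideal
    generated by u, and e = 0 makes that power vanish. The property of idempotents is a hypothesis
    so that the induction proving it can use this lemma one variable lower. *)
Lemma quasi_idempotent_nilpotent n (u : iterLaurent A n) :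
  (forall e : iterLaurent A n, e * e = e -> (forall l, nilpotent (icoef e l)) -> e = 0) ->
  nilpotent (u * (1 - u)) -> (forall l, nilpotent (icoef u l)) -> nilpotent u.
Proof.
move=> IH [N uN] nu.
have uN1 : (u * (1 - u)) ^+ N.+1 = 0 by rewrite exprS uN mulr0.
have [|p [q E]] := @comaximal_pow _ u (1 - u) N.+1 N.+1; first by rewrite addrC subrK.
pose e := u ^+ N.+1 * p.
have e1 : 1 - e = (1 - u) ^+ N.+1 * q by rewrite -{1}E -/e addrAC subrr add0r.
have ue : u ^+ N.+1 * (1 - e) = 0 by rewrite e1 mulrA -exprMn uN1 mul0r.
have ee : e * e = e.
  have : e * (1 - e) = 0 by rewrite {1}/e mulrAC ue mul0r.
  by rewrite mulrBr mulr1 => /eqP; rewrite subr_eq0 => /eqP.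
have e0 : e = 0.
  by apply: IH ee _; rewrite /e exprS -mulrA; exact: nilpotent_icoefMr.
by exists N.+1; rewrite -ue e0 subr0 mulr1.
Qed.

Lemma lcoefMn (B : comPzRingType) (f : laurent B) c k : lcoef (f *+ c) k = lcoef f k *+ c.
Proof. by elim: c => [|c IH]; rewrite ?mulr0n// !mulrS lcoefD IH. Qed.

Lemma lmono_nilpotent (B : comPzRingType) (c : B) k : nilpotent c -> nilpotent (lmono c k).
Proof.
move=> [N cN]; exists N.
have -> : lmono c k ^+ N = lmono (c ^+ N) (k *+ N).
  elim: {cN} N => [|N IH]; first by rewrite !expr0 mulr0n lmono1.
  by rewrite !exprS IH lmonoM mulrS.
by rewrite cN; apply: laurentP => i /=; case: ifP.
Qed.

(** The part of f below c is a finite sum of monomials, so for it nilpotent coefficients do give a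
    nilpotent series. *)
Lemma laurent_truncation (B : comPzRingType) (f : laurent B) c :
  exists g : laurent B,
    [/\ forall i, i < c -> lcoef g i = lcoef f i, forall i, c <= i -> lcoef g i = 0 &
        (forall i, i < c -> nilpotent (lcoef f i)) -> nilpotent g].
Proof.
have [m fm] := ordge_exists f.
exists (\sum_(k <- win (absz m + absz c) | k < c) lmono (lcoef f k) k).
have E i : lcoef (\sum_(k <- win (absz m + absz c) | k < c) lmono (lcoef f k) k) i =
    if (i \in win (absz m + absz c)) && (i < c) then lcoef f i else 0.
  rewrite lcoef_sum big_mkcond; case: ifP => [/andP[iw ic]|iwc].
    rewrite (bigD1_seq i) ?fset_uniq//= ic eqxx big1 ?addr0// => k ki.
    by rewrite eq_sym (negPf ki); case: ifP.
  rewrite big1_seq// => k /andP[_ kw] /=; case: ifP => // kc; case: eqP => // ik.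
  by rewrite ik kw kc in iwc.
split=> [i ic|i ic|nf].
- rewrite E ic andbT mem_win; case: ifP => // iw; rewrite fm//.
  by apply: contraFT iw; rewrite -leNgt => mi; lia.
- by rewrite E [i < c]ltNge ic andbF.
- by apply: nilpotent_sum => k kc; apply/lmono_nilpotent/nf.
Qed.

Lemma laurent_idempotent_nilpotent (B : comPzRingType) (e : laurent B) :
  e * e = e -> (forall k, nilpotent (lcoef e k)) -> e = 0.
Proof.
move=> ee ne; have eX (r : nat) : e ^+ r.+1 = e.
  by elim: r => [|r IH]; rewrite ?expr1// exprS IH.
have [x [x1 x2 /(_ (fun i _ => ne i))[N xN]]] := laurent_truncation e 1.
pose y := e - x.
have y1 : ordge 1 y by move=> i i1; rewrite lcoefB x1// subrr.
have [m xm] := ordge_exists x.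
(* In the expansion of (x + y)^R a term either contains x^N = 0 or has fewer than N factors x, which
   lower the order by at most |m| N. The other factors are y, more than K + |m| N of them, so the
   order is at least K. *)
apply: ordge_eq0 => K; rewrite -(eX (K + N + absz m * N)%N).
rewrite (_ : e = x + y); last by rewrite addrC subrK.
rewrite exprDn; apply: ordge_sum => i _; set R := (K + N + _).+1.
move=> k kK; rewrite lcoefMn.
have [NR|RN] := leqP N (R - i).
  by rewrite -(subnKC NR) exprD xN mul0r mul0r lcoef0 mul0rn.
have xo : ordge (- (absz m * N)%N%:Z) (x ^+ (R - i)).
  apply: ordgeW (ordgeX (p := (R - i)%N) xm).
  rewrite -mulr_natr natz.
  by move: (R - i)%N (ltnW RN) => d dN; nia.
by rewrite (ordgeM xo (ordgeX1 (j := i) y1)) ?mul0rn//; rewrite /R in RN; lia.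
Qed.

Lemma idempotent_icoef_nilpotent n (e : iterLaurent A n) :
  e * e = e -> (forall l, nilpotent (icoef e l)) -> e = 0.
Proof.
elim: n e => [|n IH] e ee ne; first by apply: idempotent_nilpotent => //; exact: (ne 0).
(* Modulo a prime of the inner ring, e or 1 - e vanishes. Hence the coefficients of e away from 0
   are nilpotent, and the one at 0 is idempotent up to a nilpotent. *)
have eP (P : Spec (iterLaurent A n)) : (forall k, k != 0 -> P (lcoef e k)) /\
    P (lcoef e 0 * (1 - lcoef e 0)).
  pose Q := MkSpec (laurent_prime P).
  have : Q (e * (1 - e)) by rewrite mulrBr mulr1 ee subrr; exact: spec0.
  case/specM => eQ.
    by split=> [k _|]; [exact: eQ|apply/specMr/eQ].
  have eQ' k : P (lcoef (1 - e) k) by exact: eQ.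
  split=> [k /negPf k0|]; last by apply/specMl; have := eQ' 0; rewrite lcoefB lcoef1.
  by have := eQ' k; rewrite lcoefB lcoef1 k0 sub0r => /specN; rewrite opprK.
apply: laurent_idempotent_nilpotent => // k.
have [->|k0] := eqVneq k 0; last by apply: nilpotentP => P; have [H _] := eP P; exact: H.
apply: quasi_idempotent_nilpotent => //; first by apply: nilpotentP => P; have [_] := eP P.
by move=> l; have := ne (colext 0 l); rewrite icoefS colext_max row'_colext.
Qed.

Lemma lex_lt_colext_lt n k (l' : 'cV[int]_n) (l : 'cV[int]_n.+1) :
  k < l ord_max 0 -> lex_lt (colext k l') l.
Proof.
move=> kl; rewrite /lex_lt /= colext_max kl /= andbT; apply/eqP => E.
by rewrite -E colext_max ltxx in kl.
Qed.

Lemma lex_lt_colext_eq n (l' : 'cV[int]_n) (l : 'cV[int]_n.+1) :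
  lex_lt l' (row' ord_max l) -> lex_lt (colext (l ord_max 0) l') l.
Proof.
move=> /andP[ll' ll]; rewrite /lex_lt /= colext_max row'_colext eqxx ll orbT andbT.
by apply: contra ll' => /eqP <-; rewrite row'_colext.
Qed.

(** With f g = 1, the products u_i = b_i c_(-i) sum to 1 and are pairwise orthogonal up to
    nilpotents. For i <> m they have nilpotent coefficients, hence are nilpotent themselves. So u_m
    and b_m are invertible, which makes b_i nilpotent for i < m; h gathers these terms and the
    nilpotent part of b_m. *)
Lemma nilpotent_lexunit_split n (f : iterLaurent A n) (l : 'cV[int]_n) :
  invertible f -> (forall k, lex_lt k l -> nilpotent (icoef f k)) ->
  invertible (icoef f l) ->
  exists g h : iterLaurent A n, [/\ f = g + h, lexunit l g & nilpotent h].
Proof.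
elim: n f l => [|n IH] f l fi nf uf.
  by exists f, 0; rewrite addr0; split=> //; exists 1; rewrite expr1.
have [g fg] := fi.
set m := l ord_max 0; pose b i := lcoef f i; pose c i := lcoef g i.
have nb i : i < m -> forall k, nilpotent (icoef (b i) k).
  by move=> im k; have := nf (colext i k) (lex_lt_colext_lt k im); rewrite icoefS colext_max row'_colext.
have nbm k : lex_lt k (row' ord_max l) -> nilpotent (icoef (b m) k).
  by move=> /lex_lt_colext_eq /nf; rewrite icoefS colext_max row'_colext.
have bcP i j (P : Spec (iterLaurent A n)) : i + j < 0 -> P (b i * c j).
  by move=> ij; apply: spec_nilpotent; exact: laurent_unit_nilpotent.
have [mf fm] := ordge_exists f; have [mg gm] := ordge_exists g.
have sum1 i : exists2 N, i \in win N & \sum_(j <- win N) b j * c (- j) = 1.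
  exists (absz mf + absz mg + absz i)%N; first by rewrite mem_win; lia.
  have bd : (absz mf + absz mg + absz 0%Z <= absz mf + absz mg + absz i)%N by lia.
  have := lcoefM_win fm gm bd; rewrite fg lcoef1 /= => E.
  by apply: (etrans _ (esym E)); apply: eq_bigr => j _; rewrite sub0r.
have uuP i j (P : Spec (iterLaurent A n)) : i != j -> P (b i * c (- i) * (b j * c (- j))).
  move=> ij; have [lij|lji] := ltP i j.
    by rewrite mulrACA [c _ * _]mulrC mulrACA; apply: specMr; apply: bcP; lia.
  rewrite mulrC mulrACA [c _ * _]mulrC mulrACA; apply: specMr; apply: bcP; lia.
have qu i : nilpotent (b i * c (- i) * (1 - b i * c (- i))).
  apply: nilpotentP => P; have [N iN E] := sum1 i.
  rewrite -{1}E (bigD1_seq i) ?fset_uniq//= addrAC subrr add0r big_distrr /=.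
  by apply: spec_sum => j ji; apply: uuP; rewrite eq_sym.
have nu i : i != m -> nilpotent (b i * c (- i)).
  move=> im; apply: quasi_idempotent_nilpotent (qu i) _.
    exact: idempotent_icoef_nilpotent.
  have [lim|lmi] := ltP i m; first by apply/nilpotent_icoefMr/nb.
  (* For i > m the product b_m c_(-i) is nilpotent, while b_m lies in no prime Q of this form
     because its coefficient at the inner part of l is a unit. *)
  move=> k; apply: nilpotentP => P; have [Q QP] := iterLaurent_prime n P.
  apply: (proj1 (QP _)).
  have : Q (b m * c (- i) * b i) by apply: specMr; apply: bcP; move: im lmi; lia.
  rewrite -mulrA [c _ * _]mulrC => /specM[]// /QP /(_ (row' ord_max l)) Pm.
  by have [d fd] := uf; case: (@spec1 _ P); rewrite -fd; exact: specMr.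
have ium : invertible (b m * c (- m)).
  have [N mN E] := sum1 m.
  move: E; rewrite (bigD1_seq m) ?fset_uniq//= => /(canRL (addrK _)) ->.
  by apply: invertible1B_nilpotent; apply: nilpotent_sum => j; exact: nu.
have ibm : invertible (b m).
  by have [d bd] := ium; exists (c (- m) * d); rewrite mulrA.
have nbi i : i < m -> nilpotent (b i).
  move=> im; apply: nilpotentP => P.
  have : P (b i * c (- m) * b m) by apply: specMr; apply: bcP; lia.
  rewrite -mulrA [c _ * _]mulrC => /specM[]// Pu.
  by have [d ud] := ium; case: (@spec1 _ P); rewrite -ud; exact: specMr.
have [|g' [h' [bE gl nh]]] := IH (b m) (row' ord_max l) ibm nbm; first exact: uf.
have [x [x1 x2 /(_ nbi) nx]] := laurent_truncation f m.
have nh' : nilpotent (x + lmono h' m).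
  by apply: nilpotentD nx _; exact: lmono_nilpotent.
exists (f - (x + lmono h' m)), (x + lmono h' m); split=> //; first by rewrite subrK.
split=> [i im|].
  by rewrite lcoefB lcoefD x1// /= (lt_eqF im) addr0 subrr.
rewrite -/m (_ : lcoef _ _ = g')//.
by rewrite lcoefB lcoefD x2// /= eqxx add0r -/(b m) bE addrK.
Qed.

End NilpotentParts.

(** * Specialization at s = 1 *)

(* Evaluation at s = 1 of Laurent series in s with finitely many terms. *)
Section Specialization.
Variable K : comPzRingType.
Implicit Types (F G : laurent K) (x y z : K).

Definition finsupport (N : nat) F := forall k, k \notin win N -> lcoef F k = 0.

(** A relation, since evaluation makes sense only for Laurent polynomials; by [eval1_sum] the value
    does not depend on the window. *)
Definition eval1 F y := exists N, finsupport N F /\ \sum_(k <- win N) lcoef F k = y.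

Lemma finsupportW N M F : (N <= M)%N -> finsupport N F -> finsupport M F.
Proof. by move=> NM FN k kM; apply: FN; move: kM; rewrite !mem_win; lia. Qed.

Lemma sum_win_shift N M F (j : int) : finsupport N F -> (N + absz j <= M)%N ->
  \sum_(k <- win M) lcoef F (k - j) = \sum_(k <- win N) lcoef F k.
Proof.
move=> FN NM; rewrite -(@fsbigTE _ _ _ _ (win M) (fun k => lcoef F (k - j))); last first.
  by move=> k kM; apply: FN; move: kM; rewrite !mem_win; lia.
rewrite -(@fsbigTE _ _ _ _ (win N) (lcoef F)) //.
rewrite [RHS](@reindex_fsbigT _ _ _ _ _ (fun k => k - j))//.
by exists (fun k => k + j) => k; lia.
Qed.

Lemma eval1_sum N F y : finsupport N F -> eval1 F y -> \sum_(k <- win N) lcoef F k = y.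
Proof.
move=> FN [M [FM <-]].
rewrite -(@sum_win_shift N (N + M) F 0 FN) ?addn0 ?leq_addr//.
by rewrite -(@sum_win_shift M (N + M) F 0 FM) ?addn0 ?leq_addl.
Qed.

Lemma eval1_sum_shift N M F y j : finsupport N F -> eval1 F y -> (N + absz j <= M)%N ->
  \sum_(k <- win M) lcoef F (k - j) = y.
Proof. by move=> FN Fy NM; rewrite (sum_win_shift FN NM); exact: eval1_sum. Qed.

Lemma finsupport_coefM N F G k : finsupport N F ->
  lcoef (F * G) k = \sum_(i <- win N) lcoef F i * lcoef G (k - i).
Proof. by move=> FN; apply: fsbigTE => i /FN ->; rewrite mul0r. Qed.

Lemma finsupportM N M F G : finsupport N F -> finsupport M G -> finsupport (N + M) (F * G).
Proof.
move=> FN GM k kNM; rewrite (finsupport_coefM _ _ FN) big1_seq// => i /andP[_].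
rewrite mem_win => iN; rewrite (GM (k - i)) ?mulr0//.
by move: kNM; rewrite !mem_win; lia.
Qed.

Lemma finsupport_lmono c i : finsupport (absz i) (lmono c i).
Proof. by move=> k; rewrite mem_win /=; case: eqP => // ->; lia. Qed.

Lemma finsupportD N F G : finsupport N F -> finsupport N G -> finsupport N (F + G).
Proof. by move=> FN GN k kN; rewrite lcoefD FN// GN// addr0. Qed.

Lemma finsupportN N F : finsupport N F -> finsupport N (- F).
Proof. by move=> FN k kN; rewrite lcoefN FN// oppr0. Qed.

Lemma finsupport_prod N (J : Type) (r : seq J) (F : J -> laurent K) :
  (forall j, finsupport N (F j)) -> finsupport (N * size r) (\prod_(j <- r) F j).
Proof.
move=> FN; elim: r => [|j r IH].
  by rewrite big_nil /= muln0 -lmono1; exact: (@finsupport_lmono 1 0).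
by rewrite big_cons /= mulnS; exact: finsupportM.
Qed.

Lemma finsupport_sum N (J : Type) (r : seq J) (F : J -> laurent K) :
  (forall j, finsupport N (F j)) -> finsupport N (\sum_(j <- r) F j).
Proof.
by move=> FN; apply: big_ind => //; exact: finsupportD.
Qed.

Lemma eval1_lmono c i : eval1 (lmono c i) c.
Proof.
exists (absz i); split; first exact: finsupport_lmono.
rewrite (bigD1_seq i) ?fset_uniq//=; last by rewrite mem_win; lia.
by rewrite eqxx big1 ?addr0// => k /negPf ->.
Qed.

Lemma eval1_1 : eval1 1 1.
Proof. by rewrite -lmono1; exact: eval1_lmono. Qed.

Lemma eval1D F G x y : eval1 F x -> eval1 G y -> eval1 (F + G) (x + y).
Proof.
move=> Fx Gy; have [N [FN _]] := Fx; have [M [GM _]] := Gy.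
have FN' := finsupportW (leq_addr M N) FN; have GM' := finsupportW (leq_addl N M) GM.
exists (N + M)%N; split; first exact: finsupportD.
rewrite -(eval1_sum FN' Fx) -(eval1_sum GM' Gy) -big_split.
by apply: eq_bigr => k _; rewrite lcoefD.
Qed.

Lemma eval1N F x : eval1 F x -> eval1 (- F) (- x).
Proof.
move=> [N [FN <-]]; exists N; split; first exact: finsupportN.
by rewrite -sumrN; apply: eq_bigr => k _; rewrite lcoefN.
Qed.

Lemma eval1M F G x y : eval1 F x -> eval1 G y -> eval1 (F * G) (x * y).
Proof.
move=> Fx Gy; have [N [FN _]] := Fx; have [M [GM _]] := Gy.
exists (N + M)%N; split; first exact: finsupportM.
under eq_bigr do rewrite (finsupport_coefM _ _ FN).
rewrite exchange_big /= -(eval1_sum FN Fx) big_distrl; apply: eq_big_seq => i iN /=.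
rewrite -big_distrr /=; congr (_ * _); apply: eval1_sum_shift GM Gy _.
by move: iN; rewrite mem_win; lia.
Qed.

Lemma eval1_prod (J : Type) (r : seq J) (F : J -> laurent K) (x : J -> K) :
  (forall j, eval1 (F j) (x j)) -> eval1 (\prod_(j <- r) F j) (\prod_(j <- r) x j).
Proof.
move=> Fx; elim: r => [|j r IH]; first by rewrite !big_nil; exact: eval1_1.
by rewrite !big_cons; exact: eval1M.
Qed.

Lemma eval1_bigsum (J : Type) (r : seq J) (F : J -> laurent K) (x : J -> K) :
  (forall j, eval1 (F j) (x j)) -> eval1 (\sum_(j <- r) F j) (\sum_(j <- r) x j).
Proof.
move=> Fx; elim: r => [|j r IH]; last by rewrite !big_cons; exact: eval1D.
rewrite !big_nil (_ : 0 = lmono 0 0 :> laurent K); first exact: eval1_lmono.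
by apply: laurentP => k /=; case: ifP.
Qed.

Lemma eval1_det m (M : 'M[laurent K]_m) (M1 : 'M[K]_m) :
  (forall i j, eval1 (M i j) (M1 i j)) -> eval1 (\det M) (\det M1).
Proof.
move=> MM; apply: eval1_bigsum => s; rewrite !mulr_sign.
by case: odd_perm; [apply: eval1N|]; apply: eval1_prod.
Qed.

Lemma finsupport_det N m (M : 'M[laurent K]_m) :
  (forall i j, finsupport N (M i j)) -> finsupport (N * m) (\det M).
Proof.
move=> MN; apply: finsupport_sum => s; rewrite mulr_sign.
have H : finsupport (N * m) (\prod_i M i (s i)).
  have := @finsupport_prod N _ (index_enum 'I_m) (fun i => M i (s i)) (fun i => MN i (s i)).
  by rewrite -[index_enum _]enumT size_enum_ord.
by case: odd_perm => //; exact: finsupportN.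
Qed.

(* [homogeneous x F]: F is a power series in x * s. *)
Definition homogeneous x F := forall k,
  (k < 0 -> lcoef F k = 0) /\ exists c, lcoef F k = c * x ^+ absz k.

Lemma homogeneous1 x : homogeneous x 1.
Proof.
move=> k; split; first exact: ordge1.
rewrite lcoef1; case: eqP => [->|_]; first by exists 1; rewrite mulr1.
by exists 0; rewrite mul0r.
Qed.

Lemma homogeneousM x F G : homogeneous x F -> homogeneous x G -> homogeneous x (F * G).
Proof.
move=> Fx Gx k; have F0 : ordge 0 F by move=> i; have [] := Fx i.
have G0 : ordge 0 G by move=> i; have [] := Gx i.
split; first exact: (ordgeM F0 G0).
rewrite (lcoefM_win F0 G0 (leqnn _)).
apply: (big_ind (fun z => exists c, z = c * x ^+ absz k)).
- by exists 0; rewrite mul0r.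
- by move=> _ _ [c ->] [d ->]; exists (c + d); rewrite mulrDl.
move=> i _; have [i0|i0] := ltP i 0; first by exists 0; rewrite F0// !mul0r.
have [ki|ki] := ltP (k - i) 0; first by exists 0; rewrite (G0 (k - i))// mulr0 mul0r.
have [_ [c ->]] := Fx i; have [_ [d ->]] := Gx (k - i).
exists (c * d); rewrite mulrACA -exprD; congr (_ * x ^+ _); lia.
Qed.

Lemma homogeneousX x F (m : nat) : homogeneous x F -> homogeneous x (F ^+ m).
Proof.
move=> Fx; elim: m => [|m IH]; first exact: homogeneous1.
by rewrite exprS; exact: homogeneousM.
Qed.

Lemma homogeneous_finsupport x F N : homogeneous x F -> x ^+ N = 0 -> finsupport N F.
Proof.
move=> Fx xN k; rewrite mem_win => kN.
have [k0|k0] := ltP k 0; first by have [->] := Fx k.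
have [_ [c ->]] := Fx k; rewrite (_ : absz k = N + (absz k - N))%N; last by lia.
by rewrite exprD xN mul0r mulr0.
Qed.

Lemma geometric_sum_nilpotent (R : comPzRingType) (u : R) N : u ^+ N = 0 ->
  (1 - u) * (\sum_(j < N) u ^+ j) = 1.
Proof.
suff -> : (1 - u) * (\sum_(j < N) u ^+ j) = 1 - u ^+ N by move=> ->; rewrite subr0.
elim: N => [|N IH]; first by rewrite big_ord0 mulr0 expr0 subrr.
by rewrite big_ord_recr /= mulrDr IH exprS mulrBl mul1r addrA subrK.
Qed.

(** Both 1 + x s and its inverse, a finite geometric series, are power series in x s, and so are
    their powers. As x^N = 0, all of them fit into one window, whatever k is. *)
Lemma zexp_linear x N k : x ^+ N = 0 ->
  [/\ invertible (1 + lmono x 1), finsupport N (zexp (1 + lmono x 1) k) &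
      eval1 (zexp (1 + lmono x 1) k) (zexp (1 + x) k)].
Proof.
move=> xN.
have monoX (m : nat) : (- lmono x 1) ^+ m = lmono ((- x) ^+ m) m%:Z.
  elim: m => [|m IH]; first by rewrite !expr0 lmono1.
  by rewrite !exprS IH -lmonoN lmonoM; congr (lmono _ _); lia.
have NxN : (- x) ^+ N = 0 by rewrite exprNn xN mulr0.
pose G := \sum_(j < N) (- lmono x 1) ^+ j; pose g := \sum_(j < N) (- x) ^+ j.
have FG : (1 + lmono x 1) * G = 1.
  rewrite -[X in 1 + X]opprK; apply: geometric_sum_nilpotent; rewrite monoX NxN.
  by apply: laurentP => i /=; case: ifP.
have fg : (1 + x) * g = 1.
  by rewrite -[X in 1 + X]opprK; exact: geometric_sum_nilpotent.
have hmono m : homogeneous x (lmono ((- x) ^+ m) m%:Z).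
  move=> i; split; first by move=> i0; rewrite /= lt_eqF//; lia.
  rewrite /=; case: eqP => [->|_]; last by exists 0; rewrite mul0r.
  by exists ((-1) ^+ m); rewrite (exprNn x).
have hD F F' : homogeneous x F -> homogeneous x F' -> homogeneous x (F + F').
  move=> Fx Fx' i; have [F1 [c F2]] := Fx i; have [F1' [c' F2']] := Fx' i.
  split; first by move=> i0; rewrite lcoefD F1// F1'// addr0.
  by exists (c + c'); rewrite lcoefD F2 F2' mulrDl.
have h0 : homogeneous x 0 by move=> i; split=> //; exists 0; rewrite mul0r.
have hF : homogeneous x (1 + lmono x 1).
  apply: hD; first exact: homogeneous1.
  move=> i; split; first by move=> i0; rewrite /= lt_eqF//; lia.
  rewrite /=; case: eqP => [->|_]; last by exists 0; rewrite mul0r.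
  by exists 1; rewrite mul1r expr1.
have hG : homogeneous x G.
  by apply: big_ind => // j _; rewrite monoX.
have eF : eval1 (1 + lmono x 1) (1 + x) by apply: eval1D; [exact: eval1_1|exact: eval1_lmono].
have eG : eval1 G g by apply: eval1_bigsum => j; rewrite monoX; exact: eval1_lmono.
have eX (F : laurent K) y (m : nat) : eval1 F y -> eval1 (F ^+ m) (y ^+ m).
  move=> Fy; elim: m => [|m IH]; first exact: eval1_1.
  by rewrite !exprS; exact: eval1M.
split; first by exists G.
  case: k => m /=; rewrite ?(inverse_uniq FG); apply: homogeneous_finsupport xN; exact: homogeneousX.
by case: k => m /=; rewrite ?(inverse_uniq FG) ?(inverse_uniq fg); exact: eX.
Qed.

End Specialization.

Section Deformation.
Variables (A : comPzRingType) (n : nat).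
Variables (phi p q : 'I_n -> iterLaurent A n).
Hypothesis phiE : forall i, phi i = p i + q i.
Hypothesis preg : lexreg p.
Hypothesis qnil : forall i, nilpotent (q i).

Local Notation K := (iterLaurent A n).

(* The system (p_i + s q_i)_i, s in one more variable s = t_(n+1): its
   specialization at s = 1 is [phi], but it has no nilpotent lower terms. *)
Definition deformation (i : 'I_n.+1) : iterLaurent A n.+1 :=
  if unlift ord_max i is Some j then lmono (p j) 0 + lmono (q j) 1 else lmono 1 1.

Lemma deformation_max : deformation ord_max = lmono 1 1.
Proof. by rewrite /deformation unlift_none. Qed.

Lemma deformation_lift j : deformation (lift ord_max j) = lmono (p j) 0 + lmono (q j) 1.
Proof. by rewrite /deformation liftK. Qed.

Lemma lexunit1 m : lexunit 0 (1 : iterLaurent A m).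
Proof.
elim: m => [|m IH]; first exact: invertible1.
split; rewrite mxE; first exact: ordge1.
by rewrite lcoef1 eqxx (_ : row' _ _ = 0)//; apply/colP => i; rewrite !mxE.
Qed.

Lemma deformation_lexreg : lexreg deformation.
Proof.
split=> [i|||].
- rewrite deformation_lift; apply: ordgeD; first exact: ordge_lmono.
  by apply: ordgeW (@ordge_lmono _ _ 1).
- by rewrite deformation_max; exact: ordge_lmono.
- by exists 0; rewrite deformation_max; exact: lexunit1.
- rewrite (_ : lead0 _ = p)//; apply: funext => i.
  by rewrite /lead0 deformation_lift lcoefD /= addr0.
Qed.

Let Psi (l : 'cV[int]_n) : laurent K :=
  \prod_(i < n) zexp (deformation (lift ord_max i)) (l i 0).

Let p_inv i : invertible (p i).
Proof. exact: lexreg_invertible. Qed.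

Let phi_inv i : invertible (phi i).
Proof.
have [a pa] := p_inv i.
have -> : phi i = p i * (1 - - (q i * a)).
  by rewrite opprK mulrDr mulr1 phiE mulrCA pa mulr1.
apply: invertibleM => //; apply: invertible1B_nilpotent.
by rewrite -mulrN; exact: nilpotentMr.
Qed.

(** Writing p_i + s q_i = p_i (1 + s x_i) with x_i nilpotent reduces this to [zexp_linear]. The
    point is that the window does not depend on l. *)
Lemma deformation_powers : exists N, forall l,
  finsupport N (Psi l) /\ eval1 (Psi l) (mpow phi l).
Proof.
pose x i := q i * inverse (p i).
have /choice[M MP] : forall i, exists M, x i ^+ M = 0.
  by move=> i; have [M qM] := qnil i; exists M; rewrite exprMn qM mul0r.
pose N := (\sum_i M i)%N.
have xN i : x i ^+ N = 0.
  by rewrite /N (bigD1 i)//= exprD MP mul0r.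
have pE i : p i * (1 + x i) = phi i.
  by rewrite mulrDr mulr1 /x mulrCA mulr_inverse// mulr1 phiE.
have ix i : invertible (1 + x i).
  rewrite -[x i]opprK; apply: invertible1B_nilpotent.
  by rewrite -mulrN1; apply: nilpotentMr; exists N.
have E i k : zexp (deformation (lift ord_max i)) k =
    lmono (zexp (p i) k) 0 * zexp (1 + lmono (x i) 1) k.
  have [iu _ _] := zexp_linear k (xN i).
  rewrite deformation_lift.
  have -> : lmono (p i) 0 + lmono (q i) 1 = lconst (p i) * (1 + lmono (x i) 1).
    by rewrite mulrDr mulr1 lconstE lmonoM add0r /x mulrCA mulr_inverse// mulr1.
  rewrite zexpM//; last exact: rmorph_invertible.
  by rewrite -rmorph_zexp//= lconstE.
exists (N * n)%N => l; split.
  have := @finsupport_prod K N _ (index_enum 'I_n)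
     (fun i => zexp (deformation (lift ord_max i)) (l i 0)).
  have -> : size (index_enum 'I_n) = n by rewrite -[index_enum _]enumT size_enum_ord.
  apply => i; rewrite E.
  have [_ H _] := zexp_linear (l i 0) (xN i).
  by have := finsupportM (@finsupport_lmono _ (zexp (p i) (l i 0)) 0) H.
apply: eval1_prod => i; rewrite E -pE zexpM//; apply: eval1M; first exact: eval1_lmono.
by have [] := zexp_linear (l i 0) (xN i).
Qed.

Let JPsi : laurent K := \det (\matrix_(i < n, j < n) lmap (ipartial j) (deformation (lift ord_max i))).

Lemma lmap_lmono (d : {additive K -> K}) c i : lmap d (lmono c i) = lmono (d c) i.
Proof. by apply: laurentP => k /=; case: ifP; rewrite ?raddf0. Qed.

(** The series s contributes the row (0, ..., 0, 1), so only the n x n determinant of derivatives in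
    t_1, ..., t_n remains, with s as a parameter. *)
Lemma deformation_jacobian :
  [/\ jacobian deformation = JPsi, exists N, finsupport N JPsi & eval1 JPsi (jacobian phi)].
Proof.
split.
- rewrite /jacobian (expand_det_row _ ord_max) (bigD1 ord_max)//= big1 ?addr0; last first.
    move=> j jmax; rewrite mxE; case: unliftP jmax => [j' _ _|->]; last by rewrite eqxx.
    rewrite deformation_max -[X in X * _]/(lmap (ipartial j') (lmono 1 1)).
    rewrite lmap_lmono derivation1; last exact: ipartial_derivation.
    by rewrite (_ : lmono 0 1 = 0) ?mul0r//; apply: laurentP => k /=; case: ifP.
  have ds : lderiv (lmono (1 : K) 1) = 1.
    apply: laurentP => k; rewrite lcoef_lderiv lcoef1 /= -subr_eq0 addrK.
    by case: eqP => [->|_]; rewrite ?mul0rz.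
  rewrite mxE unlift_none deformation_max -[X in X * _]/(lderiv (lmono 1 1)) ds.
  rewrite mul1r /cofactor addnn -signr_odd odd_double expr0 mul1r; congr (\det _).
  by apply/matrixP => i j; rewrite !mxE liftK.
- exists (1 * n)%N; apply: finsupport_det => i j; rewrite mxE deformation_lift raddfD /= !lmap_lmono.
  apply: finsupportD; last exact: (@finsupport_lmono _ _ 1).
  by apply: (@finsupportW _ 0 1) => //; exact: (@finsupport_lmono _ _ 0).
- apply: eval1_det => i j; rewrite !mxE deformation_lift raddfD /= !lmap_lmono phiE raddfD.
  by apply: eval1D; exact: eval1_lmono.
Qed.

Lemma zexp_lmono1 (j : int) : zexp (lmono (1 : K) 1) j = lmono 1 j.
Proof.
have X (m : nat) (k : int) : lmono (1 : K) k ^+ m = lmono 1 (k *+ m).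
  by elim: m => [|m IH]; rewrite ?expr0 ?lmono1// exprS IH lmonoM mulr1 mulrS.
case: j => m /=; first by rewrite X; congr lmono; rewrite pmulrn mulrzz mul1r.
rewrite (_ : inverse _ = lmono 1 (-1)); last first.
  by apply: inverse_uniq; rewrite lmonoM mulr1 subrr lmono1.
by rewrite X; congr lmono; rewrite NegzE -mulr_natr natz mulN1r.
Qed.

(** The series f, constant in s, is expanded in the deformed system. Adding up the coefficients of
    the powers of s evaluates at s = 1, and merging the terms with equal l turns the coefficients
    into the residues for phi. *)
Theorem deformation_expansion (f : iterLaurent A n) :
  usum (fun l => iconst n (res (f * mpow phi (- l - const_mx 1) * jacobian phi)) * mpow phi l) f.
Proof.
have [JE [N1 J1] Jev] := deformation_jacobian.
have [N2 PsiP] := deformation_powers.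
have colN j (l : 'cV[int]_n) : - colext j l - const_mx 1 = colext (- j - 1) (- l - const_mx 1).
  by apply/colP => i; rewrite !mxE; case: unliftP => [j' _|_]; rewrite ?mxE.
have mpowE j l : mpow deformation (colext j l) = Psi l * lmono 1 j.
  by rewrite mpow_colext deformation_max zexp_lmono1.
(* The residue in s against s^(-j-1) extracts the coefficient at s^j; it is the coefficient of s^j
   Psi_l in the expansion. *)
pose c j (l : 'cV[int]_n) := res (f * lcoef (Psi (- l - const_mx 1) * JPsi) j).
have cE j (l : 'cV[int]_n) : @res A n.+1 (lmono f 0 * mpow deformation (- colext j l - const_mx 1) * jacobian deformation) = c j l.
  rewrite colN mpowE JE resS.
  have -> : lmono f 0 * (Psi (- l - const_mx 1) * lmono 1 (- j - 1)) * JPsi =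
     lmono f 0 * (lmono 1 (- j - 1) * (Psi (- l - const_mx 1) * JPsi)) by ring.
  by rewrite !lcoef_lmonoM mul1r /c; congr (res (_ * lcoef _ _)); lia.
pose D := (N2 + N1)%N.
have GD l : finsupport D (Psi (- l - const_mx 1) * JPsi).
  by apply: finsupportM => //; case: (PsiP (- l - const_mx 1)).
have c0 j l : j \notin win D -> c j l = 0.
  by move=> jD; rewrite /c GD// mulr0 /res icoef0.
have csum l : \sum_(j <- win D) c j l = res (f * mpow phi (- l - const_mx 1) * jacobian phi).
  rewrite /c -res_sum -big_distrr /= -mulrA; congr (res (_ * _)).
  exact: (eval1_sum (GD l) (eval1M (proj2 (PsiP _)) Jev)).
have [_ xf] := @lexreg_expansion A n.+1 deformation (lmono f 0) deformation_lexreg.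
(* The nonzero terms have |j| <= D, and Psi_l lies in the window N2, so the window M contains every
   s^j Psi_l that occurs. *)
pose M := (N2 + D)%N.
have fsum : \sum_(i <- win M) lcoef (lmono f 0) i = f.
  have fM : finsupport M (lmono f 0).
    by apply: (@finsupportW _ 0 M) => //; exact: (@finsupport_lmono _ f 0).
  exact: (eval1_sum fM (eval1_lmono f 0)).
have := usum_sum (win M) xf; rewrite fsum => ys.
have yE (L : 'cV[int]_n.+1) :
    \sum_(i <- win M) lcoef (iconst n.+1 (@res A n.+1 (lmono f 0 * mpow deformation (- L - const_mx 1) *
       jacobian deformation)) * mpow deformation L) i =
    iconst n (c (L ord_max 0) (row' ord_max L)) * mpow phi (row' ord_max L).
  rewrite -{1 2}[L]colextK; set j := L ord_max 0; set l := row' _ _.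
  rewrite cE mpowE; have [jD|jD] := boolP (j \in win D); last first.
    by rewrite c0// !rmorph0 mul0r mul0r big1.
  have [PN Pev] := PsiP l.
  rewrite (eq_bigr (fun i => iconst n (c j l) * lcoef (Psi l) (i - j))); last first.
    move=> i _; rewrite [iconst n.+1 _]/= lcoef_lconstM; congr (_ * _).
    by rewrite mulrC lcoef_lmonoM mul1r.
  rewrite -big_distrr /=; congr (_ * _); apply: eval1_sum_shift PN Pev _.
  by move: jD; rewrite mem_win /M; lia.
have ys' := usum_ext yE ys.
have y0 (L : 'cV[int]_n.+1) : L ord_max 0 \notin win D ->
    iconst n (c (L ord_max 0) (row' ord_max L)) * mpow phi (row' ord_max L) = 0.
  by move=> /c0 ->; rewrite rmorph0 mul0r.
have := usum_group (fset_uniq (win D)) y0 ys'; apply: usum_ext => l.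
rewrite -csum rmorph_sum big_distrl /=; apply: eq_bigr => j _.
by rewrite colext_max row'_colext.
Qed.

End Deformation.

(** * Localization at idempotents *)

Section TriangularSystems.
Variable A : comPzRingType.

Lemma lexreg_triangular n (p : 'I_n -> iterLaurent A n) (l : 'I_n -> 'cV[int]_n) :
  (forall i, lexunit (l i) (p i)) -> (forall i j : 'I_n, (i < j)%N -> l i j 0 = 0) ->
  (forall i, l i i 0 = 1) -> lexreg p.
Proof.
elim: n p l => [//|n IH] p l lp l0 l1.
have lmax i : l (lift ord_max i) ord_max 0 = 0.
  by apply: l0; rewrite lift_max; exact: ltn_ord.
split=> [i||| ].
- by have [+ _] := lp (lift ord_max i); rewrite lmax.
- by have [+ _] := lp ord_max; rewrite l1.
- by exists (row' ord_max (l ord_max)); have [_ +] := lp ord_max; rewrite l1.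
apply: (IH _ (fun i => row' ord_max (l (lift ord_max i)))) => [i|i j ij|i].
- by have [_ +] := lp (lift ord_max i); rewrite lmax.
- by rewrite mxE; apply: l0; rewrite !lift_max.
- by rewrite mxE l1.
Qed.

Definition expansion n (phi : 'I_n -> iterLaurent A n) (f : iterLaurent A n) :=
  usum (fun l => iconst n (res (f * mpow phi (- l - const_mx 1) * jacobian phi)) * mpow phi l) f.

(* [l] is an admissible value of [nu] for the series of index [i]. *)
Definition unitriangular_col n (i : 'I_n) (l : 'cV[int]_n) :=
  (forall j : 'I_n, (i < j)%N -> l j 0 = 0) /\ l i 0 = 1.

Definition constant_nu n (i : 'I_n) (g : iterLaurent A n) := exists l,
  [/\ unitriangular_col i l, forall k, lex_lt k l -> nilpotent (icoef g k) &
      invertible (icoef g l)].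

(** The product decomposition of A expressed inside A: statements over a factor become statements
    multiplied by its idempotent e_a. The case e_a = 0 allows for zero factors, whose spectrum is
    empty and on which nu imposes nothing. *)
Definition local_nu n (i : 'I_n) (g : iterLaurent A n) :=
  exists (m : nat) (e : 'I_m -> A) (l : 'I_m -> 'cV[int]_n),
    \sum_a e a = 1 /\ forall a,
    [/\ e a * e a = e a, forall k, lex_lt k (l a) -> nilpotent (e a * icoef g k),
        exists b, e a * icoef g (l a) * b = e a & e a = 0 \/ unitriangular_col i (l a)].

Lemma constant_nu_expansion n (phi : 'I_n -> iterLaurent A n) f :
  (forall i, invertible (phi i)) -> (forall i, constant_nu i (phi i)) -> expansion phi f.
Proof.
move=> iphi /choice[l lP].
have /choice[pq pqP] i : exists pq : iterLaurent A n * iterLaurent A n,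
    [/\ phi i = pq.1 + pq.2, lexunit (l i) pq.1 & nilpotent pq.2].
  have [_ nl ul] := lP i; have [p [q H]] := nilpotent_lexunit_split (iphi i) nl ul.
  by exists (p, q).
apply: (@deformation_expansion A n phi (fun i => (pq i).1) (fun i => (pq i).2)).
- by move=> i; have [] := pqP i.
- apply: (@lexreg_triangular _ _ l) => [i|i j ij|i]; first by have [] := pqP i.
    by have [[H _] _ _] := lP i; exact: H.
  by have [[_ H] _ _] := lP i.
- by move=> i; have [] := pqP i.
Qed.

Section Localization.
Variables (n : nat) (e : A).
Local Notation E := (iconst n e).
Implicit Types x y u v : iterLaurent A n.

Let cong x y := E * x = E * y.

Let congM x y u v : cong x y -> cong u v -> cong (x * u) (y * v).
Proof. by rewrite /cong => xy uv; rewrite mulrA xy -mulrA mulrCA uv mulrCA. Qed.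

Let cong_inverse x y : invertible x -> invertible y -> cong x y -> cong (inverse x) (inverse y).
Proof.
rewrite /cong => ix iy xy.
rewrite -[LHS]mulr1 -(mulr_inverse iy) mulrACA [inverse x * _]mulrC mulrA -xy.
by rewrite -!mulrA [inverse y * _]mulrC !mulrA -[E * x * _]mulrA mulr_inverse// mulr1.
Qed.

Let congX x y m : cong x y -> cong (x ^+ m) (y ^+ m).
Proof.
by move=> xy; elim: m => [|m IH]; rewrite ?expr0// !exprS; exact: congM.
Qed.

Let cong_zexp x y k : invertible x -> invertible y -> cong x y -> cong (zexp x k) (zexp y k).
Proof.
by move=> ix iy xy; case: k => m /=; apply: congX => //; exact: cong_inverse.
Qed.

Let cong_prod (I : Type) (r : seq I) (F G : I -> iterLaurent A n) :
  (forall i, cong (F i) (G i)) -> cong (\prod_(i <- r) F i) (\prod_(i <- r) G i).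
Proof.
move=> FG; elim: r => [|i r IH]; first by rewrite !big_nil.
by rewrite !big_cons; exact: congM.
Qed.

(** Products, inverses, derivations and residues are all compatible with multiplication by the
    constant e, so the e-component of each term depends only on that of the system. *)
Lemma localized_term (phi psi : 'I_n -> iterLaurent A n) f k l :
  (forall i, invertible (phi i)) -> (forall i, invertible (psi i)) ->
  (forall i, E * phi i = E * psi i) ->
  iconst n (res (f * mpow phi k * jacobian phi)) * mpow phi l * E =
  iconst n (res (f * mpow psi k * jacobian psi)) * mpow psi l * E.
Proof.
move=> iphi ipsi E_eq.
have cpow k' : cong (mpow phi k') (mpow psi k').
  by apply: cong_prod => i; apply: cong_zexp => //; exact: E_eq.
have cjac : cong (jacobian phi) (jacobian psi).
  rewrite /cong /jacobian /determinant !big_distrr; apply: eq_bigr => s _ /=.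
  have := @cong_prod _ (index_enum 'I_n)
    (fun i => (\matrix_(i, j) ipartial j (phi i)) i (s i))
    (fun i => (\matrix_(i, j) ipartial j (psi i)) i (s i)).
  rewrite /cong mulrCA => ->; first by rewrite mulrCA.
  by move=> i; rewrite !mxE -!ipartial_iconstM E_eq.
have cres : e * res (f * mpow phi k * jacobian phi) = e * res (f * mpow psi k * jacobian psi).
  rewrite /res -!icoef_iconstM; congr (icoef _ _).
  by apply: congM cjac; apply: congM (cpow k).
rewrite !(mulrC _ E) !mulrA -!rmorphM /= cres.
by rewrite rmorphM /= -!mulrA [E * _]mulrCA cpow mulrCA.
Qed.

End Localization.

Fixpoint imono (n : nat) : 'cV[int]_n -> iterLaurent A n :=
  match n return 'cV[int]_n -> iterLaurent A n with
  | 0 => fun _ => 1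
  | n'.+1 => fun l => lmono (imono (row' ord_max l)) (l ord_max 0)
  end.

Lemma imono_invertible n (l : 'cV[int]_n) : invertible (imono l).
Proof.
elim: n l => [|n IH] l; first exact: invertible1.
exact: invertible_lmono.
Qed.

Lemma icoef_imono n (l k : 'cV[int]_n) : icoef (imono l) k = (k == l)%:R.
Proof.
elim: n l k => [|n IH] l k.
  by rewrite (_ : k == l) //; apply/eqP/colP; case.
rewrite icoefS /=; case: eqP => [klm|klm]; last first.
  rewrite icoef0; case: eqP => // kl; by rewrite kl in klm.
rewrite IH; congr ((nat_of_bool _)%:R); apply/eqP/eqP => [kl|->//].
by rewrite -[k]colextK -[l]colextK klm kl.
Qed.

(** The series are made constant one at a time: J bounds the indices of those whose nu may still
    vary. *)
Lemma local_nu_expansion n (phi : 'I_n -> iterLaurent A n) f :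
  (forall i, invertible (phi i)) -> (forall i, local_nu i (phi i)) -> expansion phi f.
Proof.
move=> iphi lphi.
suff H (J : nat) psi : (forall i, invertible (psi i)) -> (forall i, local_nu i (psi i)) ->
    (forall i : 'I_n, (J <= i)%N -> constant_nu i (psi i)) -> expansion psi f.
  by apply: (H n) => // i; rewrite leqNgt ltn_ord.
elim: J psi => [|J IH] psi ipsi lpsi cpsi; first by apply: constant_nu_expansion => // i; exact: cpsi.
have [nJ|Jn] := leqP n J.
  by apply: IH => // i Ji; have := ltn_ord i; rewrite ltnNge (leq_trans nJ Ji).
pose i0 := Ordinal Jn.
have [m [e [l [esum eP]]]] := lpsi i0.
(* As the e_a sum to 1, both f and the terms of its expansion split into their multiples by e_a,
   which are treated separately. *)
rewrite /expansion -[X in usum _ X]mulr1 -(rmorph1 (iconst n)) -esum rmorph_sum big_distrr.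
set x := fun l => _.
have xE : x =1 fun k => \sum_a x k * iconst n (e a).
  by move=> k; rewrite -big_distrr /= -rmorph_sum esum rmorph1 mulr1.
apply: usum_ext (fun k => esym (xE k)) _; apply: usum_sum => a.
have [ee ne [b eb] [e0|tl]] := eP a.
  rewrite /= e0 rmorph0 mulr0; apply: usum_ext (usum0 _ _ _) => k.
  by rewrite mulr0.
pose E := iconst n (e a); pose E' := iconst n (1 - e a).
have EE : E * E = E by rewrite -rmorphM ee.
have EE' : E * E' = 0 by rewrite -rmorphM mulrBr mulr1 ee subrr rmorph0.
have E'E' : E' * E' = E'.
  by rewrite -rmorphM mulrBr mulr1 mulrBl mul1r ee subrr subr0.
have E1 : E + E' = 1 by rewrite -rmorphD addrC subrK rmorph1.
pose g := E * psi i0 + E' * imono (l a).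
pose chi i := if i == i0 then g else psi i.
have ig : invertible g.
  have [p pp] := ipsi i0; have [t tt] := imono_invertible (l a).
  exists (E * p + E' * t); rewrite /g mulrDl !mulrDr.
  rewrite (mulrACA E _ E) (mulrACA E _ E') (mulrACA E' _ E) (mulrACA E' _ E').
  by rewrite [E' * E]mulrC EE' !mul0r addr0 add0r EE E'E' pp tt !mulr1.
have ichi i : invertible (chi i) by rewrite /chi; case: eqP.
have gc k : icoef g k = e a * icoef (psi i0) k + (1 - e a) * (k == l a)%:R.
  by rewrite icoefD !icoef_iconstM icoef_imono.
have cg : constant_nu i0 g.
  exists (l a); split=> // [k kl|].
    rewrite gc; have /andP[/negPf-> _] := kl; rewrite mulr0 addr0; exact: ne.
  (* The inverse is b on the component of e_a and 1 on the complement, where g is the monomial with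
     exponent l_a. *)
  exists (e a * b + (1 - e a)); rewrite gc eqxx mulr1.
  have e' : e a * (1 - e a) = 0 by rewrite mulrBr mulr1 ee subrr.
  transitivity (e a * e a * icoef (psi i0) (l a) * b + e a * (1 - e a) * (icoef (psi i0) (l a) + b) +
     (1 - e a) - e a * (1 - e a)); first by ring.
  by rewrite e' mul0r ee eb addr0 subr0 addrC subrK.
have lg : local_nu i0 g.
  have [l' [tl' nl' ul']] := cg.
  exists 1%N, (fun=> 1), (fun=> l'); split=> [|_]; first by rewrite big_ord1.
  split; rewrite ?mulr1//; last by right.
    by move=> k /nl'; rewrite mul1r.
  by have [d ud] := ul'; exists d; rewrite mul1r.
have chiP : expansion chi f.
  apply: IH => // i; first by rewrite /chi; case: eqP => [->|].
  rewrite /chi; case: (i =P i0) => [->//|ii0]; rewrite leq_eqVlt => /orP[/eqP Ji|Ji]; last exact: cpsi.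
  by case: ii0; apply: val_inj.
(* The systems chi and psi agree on the component of e_a, so the expansion for chi times e_a is the
   one wanted. *)
apply: usum_ext (usumMr (iconst n (e a)) chiP) => k.
apply/esym/localized_term => // i; rewrite /chi; case: eqP => // ->.
by rewrite /g mulrDr !mulrA EE EE' mul0r addr0.
Qed.

Lemma is_nu_local n (i : 'I_n) (g : iterLaurent A n) (v : 'cV[Zlc A]_n) :
  is_nu g v -> (forall j : 'I_n, (i < j)%N -> v j 0 = 0) -> v i 0 = 1 -> local_nu i g.
Proof.
move=> [m [B [pi [l [dec nl ul vl]]]]] v0 v1.
have piI a a' : (forall c, pi c a = pi c a') -> a = a'.
  move=> aa'; have [x [_ xu]] := dec (fun c => pi c a').
  by rewrite -(xu a aa') -(xu a').
(* The idempotent e_c is 1 in the factor B_c and 0 in the others. *)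
have /choice[e eP] c : exists a : A, forall c', pi c' a = (c' == c)%:R.
  by have [a [aP _]] := dec (fun c' => (c' == c)%:R); exists a.
have [b [bP _]] := dec (fun c => inverse (pi c (icoef g (l c)))).
exists m, e, l; split=> [|c].
  apply: piI => c; rewrite rmorph_sum rmorph1 (bigD1 c)//= eP eqxx big1 ?addr0// => c' cc'.
  by rewrite eP eq_sym (negPf cc').
split.
- by apply: piI => c'; rewrite rmorphM eP; case: eqP; rewrite ?mulr1 ?mulr0.
- move=> k /nl[N kN]; exists N.+1; apply: piI => c'.
  rewrite rmorphXn rmorphM eP rmorph0 exprMn; case: eqP => [->|_]; last by rewrite expr0n mul0r.
  by rewrite expr1n mul1r exprS kN mulr0.
- exists b; apply: piI => c'; rewrite !rmorphM eP bP.
  case: eqP => [->|_]; last by rewrite !mul0r.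
  by rewrite mul1r mulr_inverse.
have [e0|ne0] := pselect (e c = 0); [by left|right].
(* As e_c is nonzero, so is B_c; at the image in Spec(A) of a prime of B_c, the column v takes the
   value l_c. *)
have [q _] : exists q : Spec (B c), ~ q 1.
  apply: exists_prime => [[k]]; rewrite expr1n => B0; apply: ne0; apply: piI => c'.
  by rewrite eP rmorph0; case: eqP => [->|//].
have vE j : v j 0 (Spec_map (pi c) q) = l c j 0.
  by have /matrixP/(_ j 0) := vl c q; rewrite mxE.
by split=> [j ij|]; rewrite -vE ?v1// v0.
Qed.

End TriangularSystems.

Theorem mainTheorem11 (A : comPzRingType) (n : nat) (hn : (0 < n)%N)
    (phi : 'I_n -> iterLaurent A n)
    (phi_inv : forall i, invertible (phi i))
    (nu_trig : is_upper_trig_mx (nu_mx phi))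
    (nu_diag : forall i, nu_mx phi i i = 1)
    (f : iterLaurent A n) :
  sums_to
    (fun l : 'cV[int]_n =>
       iconst n (res (f * mpow phi (- l - const_mx 1) * jacobian phi))
       * mpow phi l)
    f.
Proof.
apply: usum_sums_to; apply: local_nu_expansion => // i.
have diag : nu (phi i) i 0 = 1 by have := nu_diag i; rewrite mxE.
have trig (j : 'I_n) : (i < j)%N -> nu (phi i) j 0 = 0.
  by move=> ij; have /is_trig_mxP/(_ i j ij) := nu_trig; rewrite !mxE.
have [nuE|nuE] := pselect (exists v, is_nu (phi i) v).
  apply: is_nu_local trig diag; rewrite /nu; case: xgetP => [v -> //|H].
  by have [v vP] := nuE; case: (H v).
(* Without a value [nu] is the junk value 0, so that A has no prime ideal. *)
have nu0 : nu (phi i) = 0.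
  by rewrite /nu; case: xgetP => // v _ vP; case: nuE; exists v.
have A0 : (1 : A) = 0.
  apply: contrapT => A1; have [P _] : exists P : Spec A, ~ P 1.
    by apply: exists_prime => [[k]]; rewrite expr1n.
  have : (nu (phi i) i 0) P = 1 by rewrite diag.
  by rewrite nu0 mxE.
(* Over the zero ring the empty family of idempotents sums to 1. *)
exists 0%N, (fun=> 0), (fun=> 0); split=> [|[]//].
by rewrite big_ord0 A0.
Qed.
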